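(* Let $l\ge 0$ and $n\ge 1$ be integers. A vector field $X$ on $\mathbb{R}^{2l+1|n}$ is a contact vector field if and only if there exists a superfunction $f\in C^\infty(\mathbb{R}^{2l+1|n})$ such that $X=X_f$, where $$X_f=f\,\partial_z-\frac12\sum_{r,s=1}^{2l+n}(-1)^{\tilde f\,\tilde T_r}\,\omega^{rs}\,T_r(f)\,T_s .$$
   Context: Superspace: $C^\infty(\mathbb{R}^{2l+1|n})=C^\infty(\mathbb{R}^{2l+1})\otimes\Lambda\mathbb{R}^n$ is the real supercommutative superalgebra of superfunctions, with even coordinates $z,x_1,\dots,x_l,y_1,\dots,y_l$ and odd coordinates $\theta_1,\dots,\theta_n$ ($\theta_i\theta_j=-\theta_j\theta_i$). A tilde denotes parity ($0$ even, $1$ odd). Vector fields are superderivations of $C^\infty(\mathbb{R}^{2l+1|n})$; they are written $X=X^z\partial_z+\sum_i(X^{x_i}\partial_{x_i}+X^{y_i}\partial_{y_i})+\sum_jX^{\theta_j}\partial_{\theta_j}$ with superfunction coefficients on the left, and form the Lie superalgebra $\mathrm{Vect}(\mathbb{R}^{2l+1|n})$ with bracket $[X,Y]=XY-(-1)^{\tilde X\tilde Y}YX$ on homogeneous elements. Here $\tilde\partial_z=\tilde\partial_{x_i}=\tilde\partial_{y_i}=0$ and $\tilde\partial_{\theta_j}=1$. Contact structure: the contact form is $\alpha=dz+\sum_{i=1}^l(x_i\,dy_i-y_i\,dx_i)+\sum_{j=1}^n\theta_j\,d\theta_j$ (even), with evaluation (in the sign conventions used, where $\langle\partial_{\theta_j},d\theta_i\rangle=-\delta_{ij}$)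 $\alpha(X)=\langle X,\alpha\rangle=X^z+\sum_i(x_iX^{y_i}-y_iX^{x_i})+\sum_jX^{\theta_j}\theta_j$. $\mathrm{Tan}(\mathbb{R}^{2l+1|n})$ denotes the set of vector fields $X$ with $\alpha(X)=0$. A vector field $X$ is a contact vector field if $[X,T]\in\mathrm{Tan}(\mathbb{R}^{2l+1|n})$ for all $T\in\mathrm{Tan}(\mathbb{R}^{2l+1|n})$. The vector fields $T_r$, $1\le r\le 2l+n$: $T_r=\partial_{x_r}+y_r\partial_z$ for $1\le r\le l$; $T_r=\partial_{y_{r-l}}-x_{r-l}\partial_z$ for $l+1\le r\le 2l$; $T_r=\partial_{\theta_{r-2l}}-\theta_{r-2l}\partial_z$ for $2l+1\le r\le 2l+n$. Thus $\tilde T_r=0$ for $r\le 2l$ and $\tilde T_r=1$ for $r>2l$. The matrix $(\omega^{rs})_{1\le r,s\le 2l+n}$ is, in blocks of sizes $l,l,n$, $(\omega^{rs})=\begin{pmatrix}0&-\mathrm{id}_l&0\\ \mathrm{id}_l&0&0\\0&0&\mathrm{id}_n\end{pmatrix}$. The formula for $X_f$ is for homogeneous $f$ and is extended linearly to arbitrary $f$ through its even and odd parts. *)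

(* Defs.v *)
From HB Require Import structures.
From mathcomp Require Import all_boot all_order all_algebra.
From mathcomp Require Import all_classical all_reals all_analysis.

Set Implicit Arguments.
Unset Strict Implicit.
Unset Printing Implicit Defensive.

Import Order.TTheory GRing.Theory Num.Theory.
Import numFieldNormedType.Exports.

Local Open Scope ring_scope.

Definition partial (R : realType) (m : nat) (i : 'I_m.+1)
    (f : 'rV[R]_m.+1 -> R) : 'rV[R]_m.+1 -> R :=
  fun x => 'D_(delta_mx 0 i) f x.

Fixpoint Ck (R : realType) (m : nat) (k : nat) (f : 'rV[R]_m.+1 -> R) : Prop :=
  continuous f /\
  if k is k'.+1 then
    forall i : 'I_m.+1,
      (forall x, derivable f x (delta_mx 0 i)) /\ Ck k' (partial i f)
  else True.

Definition smooth (R : realType) (m : nat) : pred ('rV[R]_m.+1 -> R) :=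
  fun f => `[< forall k, Ck k f >].
Arguments smooth {R m} _.

Section SmoothTheory.
Variables (R : realType) (m : nat).
Implicit Types (f g : 'rV[R]_m.+1 -> R) (k : nat) (i : 'I_m.+1).

Lemma Ck_cts k f : Ck k f -> continuous f.
Proof. by case: k => [|k] []. Qed.

Lemma CkW k f : Ck k.+1 f -> Ck k f.
Proof.
elim: k f => [|k IHk] f /= [cf df]; split=> // i.
by have [dfi Ckf] := df i; split=> //; exact: IHk.
Qed.

Lemma Ck_cst k (c : R) : Ck k (cst c : 'rV[R]_m.+1 -> R).
Proof.
elim: k c => [|k IHk] c; split=> //; try exact: cst_continuous.
move=> i; split=> [x|]; first exact: derivable_cst.
rewrite (_ : partial i _ = cst 0); first exact: IHk.
by apply/funext => x; rewrite /partial derive_cst.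
Qed.

Lemma CkD k f g : Ck k f -> Ck k g -> Ck k (f + g).
Proof.
elim: k f g => [|k IHk] f g [cf df] [cg dg]; split=> //.
- by move=> x; apply: continuousD; [exact: cf|exact: cg].
- by move=> x; apply: continuousD; [exact: cf|exact: cg].
move=> i; have [dfi Ckf] := df i; have [dgi Ckg] := dg i.
split=> [x|]; first exact: derivableD.
rewrite (_ : partial i _ = partial i f + partial i g); first exact: IHk.
by apply/funext => x; rewrite /partial deriveD.
Qed.

Lemma CkM k f g : Ck k f -> Ck k g -> Ck k (f * g).
Proof.
elim: k f g => [|k IHk] f g Cf Cg.
  by split=> // x; apply: continuousM; [exact: Cf.1|exact: Cg.1].
have [cf df] := Cf; have [cg dg] := Cg.
split; first by move=> x; apply: continuousM; [exact: cf|exact: cg].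
move=> i; have [dfi Ckf] := df i; have [dgi Ckg] := dg i.
split=> [x|]; first exact: derivableM.
rewrite (_ : partial i _ = f * partial i g + g * partial i f).
  by apply: CkD; apply: IHk => //; exact: CkW.
by apply/funext => x; rewrite /partial deriveM.
Qed.

Lemma is_derive_coord (i : 'I_m.+1) (x v : 'rV[R]_m.+1) :
  is_derive x v (fun y : 'rV[R]_m.+1 => y 0 i) (v 0 i).
Proof.
have lin : linear (fun y : 'rV[R]_m.+1 => y 0 i : R) by move=> a y z; rewrite !mxE.
pose LM := GRing.isLinear.Build R 'rV[R]_m.+1 R _ _ lin.
pose L : {linear 'rV[R]_m.+1 -> R} := HB.pack (fun y : 'rV[R]_m.+1 => y 0 i : R) LM.
have Ld : differentiable L x by exact: differentiable_coord.
split; first by apply: diff_derivable; exact: differentiable_coord.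
rewrite -[LHS]/('D_v L x) deriveE// diff_lin//.
exact: coord_continuous.
Qed.

Lemma Ck_coord k (i : 'I_m.+1) : Ck k (fun x : 'rV[R]_m.+1 => x 0 i).
Proof.
case: k => [|k]; split=> //; try exact: coord_continuous.
move=> j; split=> [x|]; first by have [] := is_derive_coord i x (delta_mx 0 j).
suff -> : partial j (fun x => x 0 i) = cst ((delta_mx 0 j : 'rV[R]_m.+1) 0 i).
  exact: Ck_cst.
by apply/funext => x; rewrite /partial; have [_ ->] := is_derive_coord i x (delta_mx 0 j).
Qed.

Lemma smoothP f : reflect (forall k, Ck k f) (smooth f).
Proof. exact: asboolP. Qed.

Lemma smooth_cst (c : R) : smooth (cst c : 'rV[R]_m.+1 -> R).
Proof. by apply/smoothP => k; exact: Ck_cst. Qed.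

Lemma smooth_coord (i : 'I_m.+1) : smooth (fun x : 'rV[R]_m.+1 => x 0 i).
Proof. by apply/smoothP => k; exact: Ck_coord. Qed.

Lemma smooth_partial i f : smooth f -> smooth (partial i f).
Proof. by move=> /smoothP Cf; apply/smoothP => k; case: (Cf k.+1) => _ /(_ i)[]. Qed.

Lemma smooth_subring_closed : subring_closed (@smooth R m).
Proof.
split=> [|f g /smoothP Cf /smoothP Cg|f g /smoothP Cf /smoothP Cg].
- exact: smooth_cst.
- apply/smoothP => k; rewrite -mulN1r; apply: CkD => //.
  by apply: CkM => //; exact: (Ck_cst k (-1)).
- by apply/smoothP => k; exact: CkM.
Qed.

Lemma smooth_scaler_closed : GRing.scaler_closed (@smooth R m).
Proof.
move=> a f /smoothP Cf; apply/smoothP => k.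
rewrite (_ : a *: f = cst a * f); last by apply/funext.
by apply: CkM => //; exact: Ck_cst.
Qed.

HB.instance Definition _ :=
  GRing.isSubringClosed.Build ('rV[R]_m.+1 -> R) smooth smooth_subring_closed.
HB.instance Definition _ :=
  GRing.isScaleClosed.Build R ('rV[R]_m.+1 -> R) smooth smooth_scaler_closed.

End SmoothTheory.

(** [smoothfun R m] is C^oo(R^(m+1)), a subring and subspace of the ring of
    all functions *)
Record smoothfun (R : realType) (m : nat) := SmoothFun {
  smoothfun_val :> 'rV[R]_m.+1 -> R;
  _ : smoothfun_val \in @smooth R m }.

Section SmoothFun.
Variables (R : realType) (m : nat).

HB.instance Definition _ := [isSub of smoothfun R m for @smoothfun_val R m].
HB.instance Definition _ := [Choice of smoothfun R m by <:].
HB.instance Definition _ := 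
  GRing.SubChoice_isSubComPzRing.Build _ _ (smoothfun R m) (@smooth_subring_closed R m).
HB.instance Definition _ := [SubZmodule_isSubLmodule of smoothfun R m by <:].

End SmoothFun.

Definition scoord (R : realType) (m : nat) (i : 'I_m.+1) : smoothfun R m :=
  SmoothFun (smooth_coord R i).

Definition spartial (R : realType) (m : nat) (i : 'I_m.+1)
    (f : smoothfun R m) : smoothfun R m :=
  SmoothFun (smooth_partial i (valP f)).

(** [f : grassmann n A] stands for the sum over [I] of [f I * theta_I] where,
    for [I = {i_1 < ... < i_k}], [theta_I] is [theta_(i_1) ... theta_(i_k)]. *)
Definition grassmann (n : nat) (A : Type) := {ffun {set 'I_n} -> A}.

HB.instance Definition _ n (A : zmodType) := GRing.Zmodule.on (grassmann n A).
HB.instance Definition _ (R : pzRingType) n (A : lmodType R) :=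
  GRing.Lmodule.on (grassmann n A).

(** [theta_I * theta_J = (-1) ^ inversions I J * theta_(I :|: J)] for disjoint
    [I] and [J] *)
Definition inversions (n : nat) (I J : {set 'I_n}) : nat :=
  (\sum_(i in I) \sum_(j in J) (j < i))%N.

Section GrassmannRing.
Variables (n : nat) (A : comPzRingType).
Implicit Types (f g h : grassmann n A) (I J K : {set 'I_n}).

Definition gmul f g : grassmann n A :=
  [ffun K : {set 'I_n} => \sum_(I : {set 'I_n} | I \subset K)
     (-1) ^+ inversions I (K :\: I) * (f I * g (K :\: I))].

Definition gone : grassmann n A := [ffun K => (K == finset.set0)%:R].

Lemma inversions0l J : inversions finset.set0 J = 0%N.
Proof. by rewrite /inversions big_set0. Qed.

Lemma inversions0r I : inversions I finset.set0 = 0%N.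
Proof. by rewrite /inversions big1// => i _; rewrite big_set0. Qed.

Lemma inversionsUl I J K : [disjoint I & J] ->
  inversions (I :|: J) K = (inversions I K + inversions J K)%N.
Proof.
by move=> dIJ; rewrite /inversions -bigU//; apply: eq_bigl => i; rewrite !inE.
Qed.

Lemma inversionsUr I J K : [disjoint J & K] ->
  inversions I (J :|: K) = (inversions I J + inversions I K)%N.
Proof.
move=> dJK; rewrite /inversions -big_split/=.
apply: eq_bigr => i _; rewrite -bigU//.
by apply: eq_bigl => j; rewrite !inE.
Qed.

Lemma gmulA : associative gmul.
Proof.
move=> f g h; apply/ffunP => K; rewrite !ffunE.
under eq_bigr => I _ do rewrite ffunE !mulr_sumr.
under [RHS]eq_bigr => J _ do rewrite ffunE mulr_suml mulr_sumr.
rewrite [RHS](exchange_big_dep (fun I => I \subset K))/=; last first.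
  by move=> J I JK IJ; exact: fintype.subset_trans IJ JK.
apply: eq_bigr => I IK.
rewrite [RHS](reindex_onto (fun J => I :|: J) (fun J => J :\: I))/=; last first.
  by move=> J /andP[_ IJ]; rewrite -[RHS](finset.setID J I) (finset.setIidPr IJ).
apply: eq_big => [J|J].
  rewrite finset.subUset IK finset.subsetUl/= finset.subsetD finset.setDUl.
  rewrite finset.setDv finset.set0U andbT; congr (_ && _).
  exact/esym/(sameP eqP finset.setDidPl).
rewrite finset.subsetD => /andP[JK dJI].
have dIJ : [disjoint I & J] by rewrite disjoint_sym.
have -> : (I :|: J) :\: I = J.
  by rewrite finset.setDUl finset.setDv finset.set0U; apply/finset.setDidPl.
rewrite finset.setDDl; set L := K :\: (I :|: J).
have KE : K :\: I = J :|: L.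
  rewrite /L -finset.setDDl -[LHS](finset.setID _ J); congr (_ :|: _).
  by apply/finset.setIidPr; rewrite finset.subsetD JK.
have dJL : [disjoint J & L].
  by rewrite disjoint_sym finset.disjoints_subset /L finset.setDE finset.setCU
     finset.setIA finset.subsetIr.
rewrite KE inversionsUl// inversionsUr// !exprD.
rewrite [f I * _]mulrCA !mulrA; congr (_ * _ * _ * _).
by rewrite -mulrA mulrC.
Qed.

Lemma gmul1l : left_id gone gmul.
Proof.
move=> f; apply/ffunP => K; rewrite ffunE (bigD1 finset.set0)/= ?finset.sub0set//.
rewrite big1 ?addr0 => [|I /andP[_ /negPf I0]]; rewrite ffunE.
  by rewrite eqxx inversions0l finset.setD0 !mul1r.
by rewrite I0 mul0r mulr0.
Qed.

Lemma gmul1r : right_id gone gmul.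
Proof.
move=> f; apply/ffunP => K; rewrite ffunE (bigD1 K)/=; last exact: subxx.
rewrite big1 ?addr0 => [|I /andP[IK nIK]]; rewrite ffunE.
  by rewrite finset.setDv eqxx inversions0r mulr1 mul1r.
rewrite finset.setD_eq0 (negPf (_ : ~~ (K \subset I))) ?mulr0//.
by apply: contra nIK => KI; rewrite finset.eqEsubset IK.
Qed.

Lemma gmulDl : left_distributive gmul +%R.
Proof.
move=> f g h; apply/ffunP => K; rewrite !ffunE -big_split/=.
by apply: eq_bigr => I _; rewrite ffunE mulrDl mulrDr.
Qed.

Lemma gmulDr : right_distributive gmul +%R.
Proof.
move=> f g h; apply/ffunP => K; rewrite !ffunE -big_split/=.
by apply: eq_bigr => I _; rewrite ffunE mulrDr mulrDr.
Qed.

HB.instance Definition _ := GRing.Zmodule_isPzRing.Build (grassmann n A)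
  gmulA gmul1l gmul1r gmulDl gmulDr.

End GrassmannRing.

Definition gconst (n : nat) (A : comPzRingType) (u : A) : grassmann n A :=
  [ffun I => if I == finset.set0 then u else 0].

Definition theta (n : nat) (A : comPzRingType) (j : 'I_n) : grassmann n A :=
  [ffun I => (I == finset.set1 j)%:R].

Definition homogeneous (n : nat) (A : comPzRingType) (p : bool)
    (f : grassmann n A) : Prop :=
  forall I : {set 'I_n}, odd #|I| != p -> f I = 0.

Definition gpart (n : nat) (A : comPzRingType) (p : bool) (f : grassmann n A)
    : grassmann n A :=
  [ffun I : {set 'I_n} => if odd #|I| == p then f I else 0].

(** [C^oo(R^(2l+1|n))], with even coordinates [z, x_1, .., x_l, y_1, .., y_l]
    in this order *)
Definition superfun (R : realType) (l n : nat) :=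
  grassmann n (smoothfun R (l + l)).

HB.instance Definition _ (R : realType) (l n : nat) :=
  GRing.PzRing.on (superfun R l n).
HB.instance Definition _ (R : realType) (l n : nat) :=
  GRing.Lmodule.on (superfun R l n).

Definition idx_z (l : nat) : 'I_(l + l).+1 := ord0.
Definition idx_x (l : nat) (i : 'I_l) : 'I_(l + l).+1 := lift ord0 (lshift l i).
Definition idx_y (l : nat) (i : 'I_l) : 'I_(l + l).+1 := lift ord0 (rshift l i).

Section Superspace.
Variables (R : realType) (l n : nat).
Local Notation SF := (superfun R l n).
Implicit Types (f g : SF) (p q : bool) (X Y T : SF -> SF).

Definition coord_even (k : 'I_(l + l).+1) : SF := gconst n (scoord R k).
Definition zc : SF := coord_even (idx_z l).
Definition xc (i : 'I_l) : SF := coord_even (idx_x i).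
Definition yc (i : 'I_l) : SF := coord_even (idx_y i).
Definition thetac (j : 'I_n) : SF := theta (smoothfun R (l + l)) j.

Definition d_even (k : 'I_(l + l).+1) f : SF := [ffun I : {set 'I_n} => spartial k (f I)].
Definition d_z : SF -> SF := d_even (idx_z l).
Definition d_x (i : 'I_l) : SF -> SF := d_even (idx_x i).
Definition d_y (i : 'I_l) : SF -> SF := d_even (idx_y i).

(** left derivative: [d_theta j (theta_j * theta_I) = theta_I] if [j \notin I] *)
Definition d_theta (j : 'I_n) f : SF :=
  [ffun I : {set 'I_n} => if j \in I then 0
     else (-1) ^+ inversions (finset.set1 j) I * f (j |: I)%SET].

Definition superderivation p X : Prop :=
  [/\ forall (a : R) f g, X (a *: f + g) = a *: X f + X g,
      forall q f, homogeneous q f -> homogeneous (q (+) p) (X f)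
    & forall q f g, homogeneous q f ->
        X (f * g) = X f * g + (-1) ^+ (p && q) * (f * X g)].

Definition vector_field X : Prop :=
  exists X0 X1, [/\ superderivation false X0, superderivation true X1
                  & forall f, X f = X0 f + X1 f].

(** the component of parity [p] of an operator *)
Definition op_part p X : SF -> SF :=
  fun f => \sum_(q : bool) gpart (q (+) p) (X (gpart q f)).

Definition bracket X Y : SF -> SF :=
  fun f => \sum_(p : bool) \sum_(q : bool)
    (op_part p X (op_part q Y f) -
     (-1) ^+ (p && q) * op_part q Y (op_part p X f)).

(** The coefficient [X^u] of [d/du] in a vector field [X], for a coordinate
    [u], is [X u]. *)
Definition contact_form X : SF :=
  X zc + \sum_(i < l) (xc i * X (yc i) - yc i * X (xc i)) +
  \sum_(j < n) X (thetac j) * thetac j.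

Definition Tan X : Prop := vector_field X /\ contact_form X = 0.

Definition contact_vector_field X : Prop :=
  vector_field X /\ forall T, Tan T -> Tan (bracket X T).

Definition Tfield (r : 'I_(l + l + n)) : SF -> SF :=
  match fintype.split r with
  | inl s =>
      match fintype.split s with
      | inl i => fun f => d_x i f + yc i * d_z f
      | inr i => fun f => d_y i f - xc i * d_z f
      end
  | inr j => fun f => d_theta j f - thetac j * d_z f
  end.

Definition Tparity (r : 'I_(l + l + n)) : bool := (l + l <= r)%N.

Definition omega : 'M[R]_(l + l + n) :=
  block_mx (block_mx 0 (- 1%:M) 1%:M 0) 0 0 1%:M.

(** [X_f] for [f] homogeneous of parity [p] *)
Definition Xham_homog p f : SF -> SF :=
  fun g => f * d_z g -
    2^-1 *: \sum_(r < l + l + n) \sum_(s < l + l + n)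
      ((-1) ^+ (p && Tparity r) * omega r s) *: (Tfield r f * Tfield s g).

Definition Xham f : SF -> SF :=
  fun g => Xham_homog false (gpart false f) g + Xham_homog true (gpart true f) g.

End Superspace.

(* Main.v *)
(** A superderivation [D] killing all coordinates is zero: by Hadamard's lemma
    every smooth [u] is, modulo the ideal generated by [x_k - a_k], independent
    of [x_k], so that [D u] vanishes at every point [a].  Hence any vector field
    expands as [X = alpha(X) d_z + sum_s X(u_s) T_s], where [u_s] is the
    coordinate dual to [T_s].  Applying the Leibniz rule to [alpha(T) = 0] and
    to [f := alpha(X)], then expanding [T f] in this frame, one finds for [X] of
    parity [p] and tangent [T] of parity [q]
<<
      alpha([X, T]) = sum_i (2 X(y_i) - T_{x_i} f) T(x_i)
                    - sum_i (2 X(x_i) + T_{y_i} f) T(y_i)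
                    + (-1)^q sum_j (2 X(theta_j) + (-1)^p T_{theta_j} f) T(theta_j).
>>
    This vanishes for all [T = T_s] iff the three brackets vanish, i.e. iff the
    components of [X] along the [T_s] are those of [X_f]. *)

From mathcomp Require Import all_boot all_order all_algebra.
From mathcomp Require Import all_classical all_reals all_analysis.
From mathcomp Require Import ring.
Require Import Defs.

Set Implicit Arguments.
Unset Strict Implicit.
Unset Printing Implicit Defensive.

Import Order.TTheory GRing.Theory Num.Theory.
Import numFieldNormedType.Exports.

Local Open Scope ring_scope.

(** * Hadamard's lemma *)

Section PartialDerivatives.
Variables (R : realType) (m : nat).
Implicit Types (F G u : 'rV[R]_m.+1 -> R) (x y : 'rV[R]_m.+1) (i j k : 'I_m.+1).

(** Hadamard's lemma is the analytic obstacle: smoothness is given by iterated partial derivatives,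
    and the quotient must have them to all orders. No integral is used. The quotients by x_k - a are
    not closed under d_k, but the quotients by all powers (x_k - a)^p of functions vanishing to
    order p are, and a Taylor formula with Lagrange remainder makes each of them continuous. Their
    tangential derivatives require partial derivatives to commute. The algebraic obstacle is sign
    bookkeeping in a ring that is not commutative. Each computation is therefore an identity in an
    arbitrary ring, with the values X(u) as variables, and its signs reduce to finite truth tables.
    The 1/2 in X_f undoes a doubling: each product X(u)T(v) in the bracket formula arises once from
    X(alpha(T)) and once from T(alpha(X)). Finally, that formula concerns homogeneous fields only.
    As alpha preserves parity, alpha([X, T_s]) = 0 separates into one condition for each homogeneous
    part of X, and a tangent field has tangent parts. *)

Lemma is_derive_line F x v (s : R) : derivable F (x + s *: v) v ->
  is_derive s (1 : R) (fun t : R => F (x + t *: v)) ('D_v F (x + s *: v)).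
Proof.
have E : (fun h : R => h^-1 *: (((fun t : R => F (x + t *: v)) \o shift s)
      (h *: (1 : R)) - F (x + s *: v))) =
    (fun h : R => h^-1 *: ((F \o shift (x + s *: v)) (h *: v) - F (x + s *: v))).
  apply/funext => h /=; congr (_ *: (F _ - _)).
  by rewrite scalerDl addrCA /GRing.scale /= mulr1.
by move=> dF; split; rewrite /derivable /derive E.
Qed.

Lemma continuous_line F x v : continuous F -> continuous (fun t : R => F (x + t *: v)).
Proof.
move=> cF t; apply: continuous_comp; last exact: cF.
by apply: cvgD; [exact: cvg_cst|apply: cvgZr_tmp; exact: cvg_id].
Qed.

(** Rolle's theorem for [s |-> F (x + s h e_j) - s ^ (p+1) * (F (x + h e_j) - F x)]
    on [0, 1]; it is the mean value theorem when [p = 0]. *)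
Lemma MVT_line (p : nat) F x (h : R) j : continuous F ->
  (forall s : R, 0 < s < 1 -> derivable F (x + (s * h) *: delta_mx 0 j) (delta_mx 0 j)) ->
  exists2 c : R, 0 < c < 1 &
    p.+1%:R * c ^+ p * (F (x + h *: delta_mx 0 j) - F x) =
    h * partial j F (x + (c * h) *: delta_mx 0 j).
Proof.
move=> cF dF.
set e := delta_mx 0 j; set d := F (x + h *: e) - F x.
pose g (s : R) := F (x + (s * h) *: e).
have dg (s : R) : 0 < s < 1 ->
    is_derive s (1 : R) g (partial j F (x + (s * h) *: e) * h).
  move=> s01; apply: (@is_derive1_comp _ (fun t => F (x + t *: e)) (fun s => s * h)).
    exact/is_derive_line/dF.
  rewrite -[X in is_derive _ _ _ X](_ : h *: (1 : R) = h); last by rewrite /GRing.scale /= mulr1.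
  have -> : (fun s => s * h) = h *: id by apply/funext => t; rewrite fctE /GRing.scale /= mulrC.
  exact: is_deriveZ.
have cg : continuous g.
  have -> : g = (fun s => F (x + s *: (h *: e))).
    by apply/funext => s; rewrite scalerA.
  exact: continuous_line.
pose f (s : R) := g s - d * s ^+ p.+1.
have fE : f = g - d *: (id ^+ p.+1).
  by apply/funext => t; rewrite /f !fctE /GRing.scale.
have df (s : R) : 0 < s < 1 -> is_derive s (1 : R) f
    (partial j F (x + (s * h) *: e) * h - d * (p.+1%:R * s ^+ p)).
  move=> s01.
  rewrite fE; apply: is_derive_eq.
    by apply: is_deriveB; exact: dg.
  by rewrite /GRing.scale /= mulr1.
have cf : continuous f.
  move=> s; apply: cvgB; first exact: cg.
  by apply: cvgM; [exact: cvg_cst|exact: exprn_continuous].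
have [||||c c01 dfc] := @Rolle R f 0 1.
- by [].
- by move=> s; rewrite in_itv/= => /df[].
- exact: continuous_subspaceT.
- by rewrite /f /g /d !(mul0r, scale0r, addr0, expr0n, mulr0, subr0, mul1r, expr1n, mulr1) subKr.
rewrite in_itv/= in c01; exists c => //.
have [_ E] := df c c01; have [_ E0] := dfc.
move: E; rewrite E0 => /esym/eqP; rewrite subr_eq0 => /eqP E.
by rewrite [RHS]mulrC E [RHS]mulrC.
Qed.

Lemma smooth_continuous F : smooth F -> continuous F.
Proof. by move=> /smoothP/(_ 0%N)/Ck_cts. Qed.

Lemma smooth_derivable F j x : smooth F -> derivable F x (delta_mx 0 j).
Proof. by move=> /smoothP/(_ 1%N)[_ /(_ j)[]]. Qed.

Lemma near_coord x (P : 'rV[R]_m.+1 -> Prop) : (\forall y \near x, P y) ->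
  exists2 d : R, 0 < d & forall y, (forall j, `|x 0 j - y 0 j| < d) -> P y.
Proof.
move=> /nbhs_ballP[d /= d0 dP]; exists d => // y xy.
by apply: dP; split=> // i j; rewrite ord1; exact: xy.
Qed.

Lemma coord_near x (P : 'rV[R]_m.+1 -> Prop) (d : R) : 0 < d ->
  (forall y, (forall j, `|x 0 j - y 0 j| < d) -> P y) -> \forall y \near x, P y.
Proof.
move=> d0 dP; apply/nbhs_ballP; exists d => // y [_ xy]; apply: dP => j.
exact: xy.
Qed.

Lemma row_lineE x (h : R) j k :
  (x + h *: delta_mx 0 j) 0 k = x 0 k + (if k == j then h else 0).
Proof. by rewrite !mxE eqxx/=; case: eqP => _; rewrite ?mulr1 ?mulr0. Qed.

Lemma is_derive_translate F w x v : derivable F (x + w) v ->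
  is_derive x v (fun y => F (y + w)) ('D_v F (x + w)).
Proof.
have E : (fun h : R => h^-1 *: (((fun y => F (y + w)) \o shift x)
      (h *: v) - F (x + w))) =
    (fun h : R => h^-1 *: ((F \o shift (x + w)) (h *: v) - F (x + w))).
  by apply/funext => h /=; rewrite addrA.
by move=> dF; split; rewrite /derivable /derive E.
Qed.

(** Two mean value theorems: along e_i for [G y = F (y + h e_j) - F y], then along e_j for
    [partial i F]. *)
Lemma mixed_difference F x (h : R) i j : smooth F -> i != j -> 0 < h ->
  exists2 y : 'rV[R]_m.+1, forall k, `|x 0 k - y 0 k| < h &
    F (x + h *: delta_mx 0 i + h *: delta_mx 0 j) - F (x + h *: delta_mx 0 i)
      - (F (x + h *: delta_mx 0 j) - F x) = h ^+ 2 * partial j (partial i F) y.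
Proof.
move=> sF nij h0; pose w : 'rV[R]_m.+1 := h *: delta_mx 0 j.
pose G := (fun y => F (y + w)) - F.
have dG y : is_derive y (delta_mx 0 i) G (partial i F (y + w) - partial i F y).
  apply: is_deriveB; first exact/is_derive_translate/smooth_derivable.
  exact/derivableP/smooth_derivable.
have cG : continuous G.
  move=> y; apply: continuousB; last exact: smooth_continuous.
  have cw : {for y, continuous (fun z : 'rV[R]_m.+1 => z + w)}.
    by apply: (@continuousD _ _ _ id (cst w)); [exact: cvg_id|exact: cst_continuous].
  by apply: (continuous_comp cw); exact: smooth_continuous.
have [||c /andP[c0 c1]] := @MVT_line 0 G x h i.
- exact: cG.
- by move=> s _; have [] := dG (x + (s * h) *: delta_mx 0 i).
rewrite expr0 !mul1r => Gc.
have [||c' /andP[c'0 c'1]] :=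
    @MVT_line 0 (partial i F) (x + (c * h) *: delta_mx 0 i) h j.
- exact/smooth_continuous/smooth_partial.
- by move=> s _; exact/smooth_derivable/smooth_partial.
rewrite expr0 !mul1r => Fc.
exists (x + (c * h) *: delta_mx 0 i + (c' * h) *: delta_mx 0 j).
  move=> k; rewrite !row_lineE opprD addrA opprD addrA subrr sub0r.
  have [->|_] := eqVneq k i; last first.
    rewrite oppr0 sub0r normrN; case: eqP => _; last by rewrite normr0.
    by rewrite gtr0_norm ?mulr_gt0// gtr_pMl.
  by rewrite (negPf nij) subr0 normrN gtr0_norm ?mulr_gt0// gtr_pMl.
transitivity (G (x + h *: delta_mx 0 i) - G x); first by [].
have [_ E] := dG (x + (c * h) *: delta_mx 0 i).
by rewrite Gc /partial E Fc mulrA expr2.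
Qed.

(** The second difference of F with step h is symmetric in i and j. By [mixed_difference] it is h^2
    times either mixed derivative, each taken at some point within h of x, and continuity brings
    both values to x. *)
Lemma partialC F i j : smooth F -> partial i (partial j F) = partial j (partial i F).
Proof.
move=> sF; have [->//|nij] := eqVneq i j; apply/funext => x.
have squeeze (p q : R) : (forall e : R, 0 < e -> exists2 r, `|p - r| < e & `|q - r| < e) ->
    p = q.
  move=> close; apply/eqP; rewrite -subr_eq0 -normr_eq0 eq_le normr_ge0 andbT.
  apply/ler_addgt0Pl => e e0; rewrite addr0.
  have [|r pr qr] := close (e / 2); first by rewrite divr_gt0.
  rewrite -(subrKA r) (splitr e) (le_trans (ler_normD _ _))// ltW// ltrD//.
  by rewrite distrC.
have swap (a b c d p q : R) : a - b - (c - d) = p -> a - c - (b - d) = q -> p = q.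
  by move=> <- <-; ring.
have near_eq k l (e : R) : 0 < e ->
    exists2 d : R, 0 < d & forall y, (forall j, `|x 0 j - y 0 j| < d) ->
      `|partial k (partial l F) x - partial k (partial l F) y| < e.
  move=> e0; apply: near_coord.
  have : continuous (partial k (partial l F)).
    by apply: smooth_continuous; do 2!apply: smooth_partial.
  by move=> /(_ x)/cvgrPdist_lt; exact.
apply: squeeze => e e0.
have [d d0 dE] := near_eq i j _ e0; have [d' d'0 d'E] := near_eq j i _ e0.
have [h [h0 hd hd']] : exists h : R, [/\ 0 < h, h <= d & h <= d'].
  by exists (Num.min d d'); rewrite lt_min d0 d'0 !ge_min !lexx orbT.
have [y xy yE] := mixed_difference x sF nij h0.
have nji : j != i by rewrite eq_sym.
have [z xz zE] := mixed_difference x sF nji h0.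
have yz : partial j (partial i F) y = partial i (partial j F) z.
  have h2 : h ^+ 2 != 0 by rewrite expf_neq0// gt_eqF.
  by apply: (mulfI h2); rewrite (addrAC x) in zE; exact: swap yE zE.
exists (partial i (partial j F) z).
  by apply: dE => k; exact: lt_le_trans (xz k) hd.
rewrite -yz; apply: d'E => k.
exact: lt_le_trans (xy k) hd'.
Qed.

End PartialDerivatives.

(** * Division of a smooth function by powers of x_k - a *)

Section HyperplaneDivision.
Variables (R : realType) (m : nat) (k : 'I_m.+1) (a : R).
Implicit Types (F G u : 'rV[R]_m.+1 -> R) (x y : 'rV[R]_m.+1) (j : 'I_m.+1).
Local Notation e := (delta_mx 0 k : 'rV[R]_m.+1).

Lemma is_derive_eq_line F G x j (d : R) :
  (forall h : R, F (x + h *: delta_mx 0 j) = G (x + h *: delta_mx 0 j)) ->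
  is_derive x (delta_mx 0 j) G d -> is_derive x (delta_mx 0 j) F d.
Proof.
move=> FG dG; have E : (fun h : R => h^-1 *: ((F \o shift x) (h *: delta_mx 0 j) - F x)) =
    (fun h : R => h^-1 *: ((G \o shift x) (h *: delta_mx 0 j) - G x)).
  apply/funext => h /=; rewrite [h *: _ + x]addrC FG.
  by have := FG 0; rewrite scale0r addr0 => ->.
by case: dG => dG dE; split; rewrite /derivable /derive E.
Qed.

Lemma is_derive_partial F x j : smooth F -> is_derive x (delta_mx 0 j) F (partial j F x).
Proof. by move=> sF; exact/derivableP/smooth_derivable. Qed.

Lemma continuous_nonexpansive F (P : 'rV[R]_m.+1 -> 'rV[R]_m.+1) :
  (forall x y j, `|P x 0 j - P y 0 j| <= `|x 0 j - y 0 j|) ->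
  continuous F -> continuous (F \o P).
Proof.
move=> lP cF x; apply/(@cvgrPdist_lt _ _ _ _ (nbhs_filter x)) => eps eps0.
have /cvgrPdist_lt/(_ _ eps0)/near_coord[d d0 dP] := cF (P x).
apply: (coord_near d0) => y xy; apply: dP => j.
exact: le_lt_trans (xy j).
Qed.

Definition hproj x := x + (a - x 0 k) *: e.

Lemma hprojE x j : hproj x 0 j = if j == k then a else x 0 j.
Proof.
by rewrite row_lineE; case: eqP => [->|_]; rewrite ?addr0// addrC subrK.
Qed.

Lemma hproj_id x : x 0 k = a -> hproj x = x.
Proof. by move=> xk; rewrite /hproj xk subrr scale0r addr0. Qed.

Lemma hprojK x : hproj x + (x 0 k - a) *: e = x.
Proof. by rewrite /hproj -addrA -scalerDl -opprB addNr scale0r addr0. Qed.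

Lemma hproj_line x h j :
  hproj (x + h *: delta_mx 0 j) = if j == k then hproj x else hproj x + h *: delta_mx 0 j.
Proof.
apply/rowP => i; rewrite hprojE row_lineE.
case: (eqVneq j k) => [->|jk]; first by rewrite hprojE; case: eqP => // _; rewrite addr0.
rewrite row_lineE hprojE; case: (eqVneq i k) => // ->.
by rewrite eq_sym (negPf jk) addr0.
Qed.

Lemma continuous_hproj F : continuous F -> continuous (F \o hproj).
Proof.
apply: continuous_nonexpansive => x y j; rewrite !hprojE.
by case: (j == k); rewrite // subrr normr0 normr_ge0.
Qed.

(** The composite is constant on lines parallel to e_k, and on a line in another coordinate
    direction [hproj] acts as a translation. Each partial derivative is thus 0 or again of the form
    [partial j F \o hproj], which feeds the induction. *)
Lemma smooth_hproj F : smooth F -> smooth (F \o hproj).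
Proof.
move=> /smoothP sF; apply/smoothP => n; elim: n F sF => [|n IH] F sF.
  by split=> //; apply: continuous_hproj; exact: Ck_cts (sF 0%N).
split=> [|j]; first by apply: continuous_hproj; exact: Ck_cts (sF 0%N).
have dFP x : is_derive x (delta_mx 0 j) (F \o hproj)
    (if j == k then 0 else partial j F (hproj x)).
  case: (eqVneq j k) => jk.
    apply: (@is_derive_eq_line _ (cst (F (hproj x)))) => h.
    by rewrite /= hproj_line jk eqxx.
  apply: (@is_derive_eq_line _ (fun y => F (y + (hproj x - x)))) => [h|].
    by rewrite /= hproj_line (negPf jk) [x + _ + _]addrC addrA subrK.
  have -> : partial j F (hproj x) = 'D_(delta_mx 0 j) F (x + (hproj x - x)).
    by rewrite addrC subrK.
  by apply/is_derive_translate/smooth_derivable/smoothP.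
split=> [x|]; first by have [] := dFP x.
have -> : partial j (F \o hproj) =
    (if j == k then cst 0 else partial j F \o hproj).
  by apply/funext => x; rewrite /partial; have [_ ->] := dFP x; case: eqP.
case: eqP => _; first exact: Ck_cst.
by apply: IH; apply/smoothP/smooth_partial/smoothP.
Qed.

(** Vanishing to order p along the hyperplane x_k = a. Only normal derivatives are tested;
    tangential derivatives inherit the property because partial derivatives commute. *)
Definition flat (p : nat) F : Prop :=
  forall i x, (i < p)%N -> x 0 k = a -> iter i (partial k) F x = 0.

(** [F / (x_k - a) ^ p], extended by its limit on the hyperplane [x_k = a] when
    [F] is [flat p].  These quotients are stable under partial derivatives, since
    [d_k (F / (x_k - a) ^ p) = ((x_k - a) d_k F - p F) / (x_k - a) ^ (p + 1)] with
    a numerator that is [flat (p + 1)]; so they are smooth as soon as they are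
    continuous. *)
Definition hquot (p : nat) F x : R :=
  if x 0 k == a then iter p (partial k) F x / p`!%:R else F x / (x 0 k - a) ^+ p.

Lemma smooth_iter p F : smooth F -> smooth (iter p (partial k) F).
Proof. by move=> sF; elim: p => //= p; exact: smooth_partial. Qed.

Lemma iter_partialC p j F : smooth F ->
  iter p (partial k) (partial j F) = partial j (iter p (partial k) F).
Proof.
by move=> sF; elim: p => //= p ->; rewrite partialC//; exact: smooth_iter.
Qed.

Lemma flat_partial p j F : smooth F -> j != k -> flat p F -> flat p (partial j F).
Proof.
move=> sF jk fF i x ip xk; rewrite iter_partialC//.
suff [_ dE] : is_derive x (delta_mx 0 j) (iter i (partial k) F) 0 by exact: dE.
apply: (@is_derive_eq_line _ (cst 0)) => h; apply: fF => //.
by rewrite row_lineE eq_sym (negPf jk) addr0.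
Qed.

(** Taylor's formula with Lagrange remainder, valid on the hyperplane too, where y = x. That y is
    coordinatewise no farther from the hyperplane than x is what continuity there will need. *)
Lemma hquot_taylor p F x : smooth F -> flat p F ->
  exists y : 'rV[R]_m.+1, [/\ forall j, j != k -> y 0 j = x 0 j,
    `|y 0 k - a| <= `|x 0 k - a| & hquot p F x = iter p (partial k) F y / p`!%:R].
Proof.
elim: p F x => [|p IH] F x sF fF.
  by exists x; split=> //; rewrite /hquot; case: eqP.
have [xk|xk] := eqVneq (x 0 k) a; first by exists x; split=> //; rewrite /hquot xk eqxx.
set h := x 0 k - a.
have h0 : h != 0 by rewrite subr_eq0.
(* The weight c^p of this mean value theorem turns the division of F x by h^(p+1) into a division of
   [partial k F w] by (c h)^p, which is [hquot p (partial k F) w] up to the factor p + 1. *)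
have [||c /andP[c0 c1]] := @MVT_line R m p F (hproj x) h k.
- exact: smooth_continuous.
- by move=> s _; exact: smooth_derivable.
have F0 : F (hproj x) = 0 by apply: (fF 0%N); rewrite // hprojE eqxx.
rewrite hprojK F0 subr0.
set w := _ + (c * h) *: _ => Fw.
have wk : w 0 k - a = c * h by rewrite row_lineE hprojE !eqxx addrC addKr.
have cn0 : c != 0 by rewrite gt_eqF.
have [||y [yj yk yE]] := IH (partial k F) w.
- exact: smooth_partial.
- by move=> i z ip zk; rewrite -iterSr; exact: fF.
exists y; split.
- by move=> j jk; rewrite yj// row_lineE hprojE (negPf jk) addr0.
- rewrite (le_trans yk)// wk normrM -/h -[leRHS]mul1r ler_wpM2r//.
  by rewrite gtr0_norm// ltW.
have -> : iter p.+1 (partial k) F y / (p.+1)`!%:R =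
    p.+1%:R^-1 * (iter p (partial k) (partial k F) y / p`!%:R).
  by rewrite iterSr factS natrM invfM mulrCA.
rewrite -yE /hquot -[w 0 k == a]subr_eq0 wk mulf_eq0 (negPf cn0) (negPf h0)/= (negPf xk) -/h.
have p0 : p.+1%:R != 0 :> R by rewrite pnatr_eq0.
have -> : F x = h * partial k F w / (p.+1%:R * c ^+ p).
  by rewrite -Fw mulrC mulKf// mulf_neq0// expf_neq0.
rewrite exprMn exprS; move: p0 => {Fw}; move: (p.+1%:R : R) => q q0.
have cp0 : c ^+ p != 0 by rewrite expf_neq0.
have hp0 : h ^+ p != 0 by rewrite expf_neq0.
by field; rewrite h0 q0 cp0 hp0.
Qed.

(** Off the hyperplane this is a quotient of continuous functions. At a point x on it,
    [hquot_taylor] replaces the value at y by that of d_k^p F / p! at a point z that is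
    coordinatewise no farther from x than y is. *)
Lemma continuous_hquot p F : smooth F -> flat p F -> continuous (hquot p F).
Proof.
move=> sF fF x; have [xk|xk] := eqVneq (x 0 k) a; last first.
  have d0 : 0 < `|x 0 k - a| by rewrite normr_gt0 subr_eq0.
  have nE : \forall y \near x, F y * ((y 0 k - a) ^+ p)^-1 = hquot p F y.
    apply: (coord_near d0) => y xy; rewrite /hquot; case: eqP => // yk.
    by have := xy k; rewrite yk ltxx.
  suff : {for x, continuous (fun y : 'rV[R]_m.+1 => F y * ((y 0 k - a) ^+ p)^-1)}.
    rewrite /continuous_at {2}/hquot (negPf xk) => cQ.
    apply: cvg_trans cQ; exact: (@near_eq_cvg _ _ _ (nbhs_filter x) _ _ nE).
  apply: continuousM; first exact: smooth_continuous.
  apply: continuousV; first by rewrite expf_neq0// subr_eq0.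
  apply: (@continuous_comp _ _ _ (fun y : 'rV[R]_m.+1 => y 0 k - a) (fun s => s ^+ p)).
    apply: continuousB; [exact: coord_continuous|exact: cst_continuous].
  exact: exprn_continuous.
apply/(@cvgrPdist_lt _ _ _ _ (nbhs_filter x)) => eps eps0.
have cdF : continuous (iter p (partial k) F) by exact/smooth_continuous/smooth_iter.
have p0 : 0 < p`!%:R :> R by rewrite ltr0n fact_gt0.
have /cvgrPdist_lt/(_ (eps * p`!%:R)) := cdF x.
rewrite mulr_gt0// => /(_ isT)/near_coord[d d0 dP].
apply: (coord_near d0) => y xy.
have [z [zj zk ->]] := hquot_taylor y sF fF.
rewrite /hquot xk eqxx -mulrBl normrM normfV (gtr0_norm p0) ltr_pdivrMr//.
apply: dP => j; have [->|jk] := eqVneq j k; last by rewrite zj.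
by rewrite xk distrC (le_lt_trans zk)// -xk distrC.
Qed.

Definition hquot_num p F : 'rV[R]_m.+1 -> R :=
  (fun x => x 0 k - a) * partial k F - p%:R *: F.

Lemma smoothM F G : smooth F -> smooth G -> smooth (F * G).
Proof. by have [_ _] := @smooth_subring_closed R m; exact. Qed.

Lemma smoothB F G : smooth F -> smooth G -> smooth (F - G).
Proof. by have [_ + _] := @smooth_subring_closed R m; exact. Qed.

Lemma smooth_hquot_num p F : smooth F -> smooth (hquot_num p F).
Proof.
move=> sF; apply: smoothB; last exact: smooth_scaler_closed.
apply: smoothM; last exact: smooth_partial.
by apply: smoothB; [exact: smooth_coord|exact: smooth_cst].
Qed.

Lemma iter_hquot_num p i F : smooth F ->
  iter i (partial k) (hquot_num p F) =
  (fun x => (x 0 k - a) * iter i.+1 (partial k) F x + (i%:R - p%:R) * iter i (partial k) F x).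
Proof.
move=> sF; elim: i => [|i IH].
  by apply/funext => x; rewrite /= sub0r mulNr.
rewrite iterS IH; apply/funext => x.
have dl : is_derive x e (fun x : 'rV[R]_m.+1 => x 0 k - a) 1.
  have := is_deriveB (is_derive_coord k x e) (is_derive_cst a x e).
  by rewrite subr0 !mxE !eqxx.
have dF1 := is_derive_partial x k (smooth_iter i.+1 sF).
have dF0 := is_derive_partial x k (smooth_iter i sF).
have [_] := is_deriveD (is_deriveM dl dF1) (is_deriveZ (i%:R - p%:R) dF0).
rewrite /partial => E; rewrite [LHS]E /GRing.scale /= mulr1 -addrA; congr (_ + _).
by rewrite -(natr1 i) addrAC [RHS]mulrDl mul1r addrC.
Qed.

(** On the hyperplane the i-th normal derivative of the numerator is (i - p) d_k^i F: flatness of F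
    kills it for i < p, and the coefficient kills it for i = p, which gains one order. *)
Lemma flat_hquot_num p F : smooth F -> flat p F -> flat p.+1 (hquot_num p F).
Proof.
move=> sF fF i x; rewrite ltnS leq_eqVlt iter_hquot_num// => ip xk.
rewrite xk subrr mul0r add0r; case/orP: ip => [/eqP->|ip]; first by rewrite subrr mul0r.
by rewrite fF// mulr0.
Qed.

(** Off the hyperplane this is the quotient rule. On it, the mean value theorem equates a difference
    quotient with the derivative at an intermediate point off the hyperplane, and the candidate
    derivative is already known to be continuous. *)
Lemma is_derive_hquot p F x : smooth F -> flat p F ->
  is_derive x e (hquot p F) (hquot p.+1 (hquot_num p F) x).
Proof.
move=> sF fF; set Q := hquot p F; set Q' := hquot p.+1 (hquot_num p F).
have off y : y 0 k != a -> is_derive y e Q (Q' y).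
  move=> yk; have d0 : 0 < `|y 0 k - a| by rewrite normr_gt0 subr_eq0.
  have yk0 : y 0 k - a != 0 by rewrite subr_eq0.
  have dl : is_derive y e (fun x : 'rV[R]_m.+1 => x 0 k - a) 1.
    have := is_deriveB (is_derive_coord k y e) (is_derive_cst a y e).
    by rewrite subr0 !mxE !eqxx.
  have dlX := is_deriveX p dl.
  have lp0 : ((fun x : 'rV[R]_m.+1 => x 0 k - a) ^+ p) y != 0 by rewrite fctE expf_neq0.
  have dlV : is_derive y e (fun z => (((fun x : 'rV[R]_m.+1 => x 0 k - a) ^+ p) z)^-1)
      (- ((y 0 k - a) ^+ p) ^- 2 * (p%:R * (y 0 k - a) ^+ p.-1)).
    split; first by apply: derivableV => //; have [] := dlX.
    rewrite deriveV//; have [_ ->] := dlX.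
    by rewrite fctE /GRing.scale /= mulr1.
  have := is_deriveM (is_derive_partial y k sF) dlV.
  set d := (X in is_derive _ _ _ X); have -> : d = Q' y.
    rewrite /d /Q' /hquot (negPf yk) /hquot_num !fctE /GRing.scale /=.
    move: (F y) (partial k F y) (y 0 k - a) yk0 => u v t t0.
    (* The power rule involves [p.-1], which truncates at p = 0. *)
    case: p {sF fF Q Q' dlX lp0 dlV d} => [|p].
      by rewrite !expr0 mul0r !mulr0 expr1; field.
    have tp0 : t ^+ p != 0 by rewrite expf_neq0.
    move: (p.+1%:R : R) => q; rewrite /= !exprS; field.
    by rewrite t0 tp0.
  move=> dq; apply: near_eq_is_derive dq; apply: (coord_near d0) => z yz.
  rewrite /Q /hquot !fctE; case: eqP => // zk.
  by have := yz k; rewrite zk ltxx.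
have [xk|xk] := eqVneq (x 0 k) a; last exact: off.
have cQ' : continuous Q'.
  by apply: continuous_hquot; [exact: smooth_hquot_num|exact: flat_hquot_num].
have cQ : continuous Q by exact: continuous_hquot.
have lim : ((fun h : R => h^-1 *: ((Q \o shift x) (h *: e) - Q x)) @ 0^' --> Q' x)%classic.
  apply/cvgrPdist_lt => eps eps0.
  have /cvgrPdist_lt/(_ _ eps0)/near_coord[d d0 dP] := cQ' x.
  near=> h.
  have h0 : h != 0 by near: h; exact: nbhs_dnbhs_neq.
  have hd : `|h| < d by near: h; exact: dnbhs0_lt.
  have [||c /andP[c0 c1]] := @MVT_line R m 0 Q x h k.
  - exact: cQ.
  - move=> s /andP[s0 s1]; have [|dQ _ //] := off (x + (s * h) *: e).
    by rewrite row_lineE eqxx xk -subr_eq0 addrC addKr mulf_neq0// gt_eqF.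
  rewrite expr0 !mul1r /= => Qc; rewrite [h *: e + x]addrC Qc.
  have [|_ cE] := off (x + (c * h) *: e).
    by rewrite row_lineE eqxx xk -subr_eq0 addrC addKr mulf_neq0// gt_eqF.
  rewrite /partial cE /GRing.scale /= mulKf//; apply: dP => j.
  rewrite row_lineE opprD addrA subrr sub0r normrN.
  case: ifP => _; last by rewrite normr0.
  by rewrite normrM (le_lt_trans _ hd)// ler_piMl// gtr0_norm// ltW.
by split; [apply/cvg_ex; exists (Q' x)|exact: cvg_lim lim].
Unshelve. all: by end_near. Qed.

(** Along e_j the coordinate x_k does not change, so on that line the quotient is a constant
    multiple of F or, inside the hyperplane, of d_k^p F. *)
Lemma is_derive_hquot_neq p F x j : smooth F -> flat p F -> j != k ->
  is_derive x (delta_mx 0 j) (hquot p F) (hquot p (partial j F) x).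
Proof.
move=> sF fF jk.
have lineE h : (x + h *: delta_mx 0 j) 0 k = x 0 k.
  by rewrite row_lineE eq_sym (negPf jk) addr0.
have scaleE (c : R) G : (forall y, y 0 k = x 0 k -> hquot p F y = c * G y) -> smooth G ->
    is_derive x (delta_mx 0 j) (hquot p F) (c * partial j G x).
  move=> QG sG; apply: (@is_derive_eq_line _ (c *: G)) => [h|]; first by rewrite QG.
  exact/is_deriveZ/is_derive_partial.
rewrite {2}/hquot; case: ifP => xk.
  rewrite iter_partialC// mulrC; apply: scaleE; last exact: smooth_iter.
  by move=> y yk; rewrite /hquot yk xk mulrC.
by rewrite mulrC; apply: scaleE => // y yk; rewrite /hquot yk xk mulrC.
Qed.

(** The induction on the order of differentiability runs over all p and F at once, since d_k raises
    p by one. *)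
Lemma smooth_hquot p F : smooth F -> flat p F -> smooth (hquot p F).
Proof.
move=> sF fF; apply/smoothP => n; elim: n p F sF fF => [|n IH] p F sF fF.
  by split=> //; exact: continuous_hquot.
split=> [|j]; first exact: continuous_hquot.
have [->|jk] := eqVneq j k.
  split=> [x|]; first by have [] := is_derive_hquot x sF fF.
  have -> : partial k (hquot p F) = hquot p.+1 (hquot_num p F).
    by apply/funext => x; have [_] := is_derive_hquot x sF fF.
  by apply: IH; [exact: smooth_hquot_num|exact: flat_hquot_num].
split=> [x|]; first by have [] := is_derive_hquot_neq x sF fF jk.
have -> : partial j (hquot p F) = hquot p (partial j F).
  by apply/funext => x; have [_] := is_derive_hquot_neq x sF fF jk.
by apply: IH; [exact: smooth_partial|exact: flat_partial].
Qed.

(** The difference [u - u \o hproj] vanishes on the hyperplane, hence is [flat 1], and g is its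
    quotient by x_k - a. *)
Lemma hadamard u : smooth u ->
  exists2 g, smooth g & forall x, u x = u (hproj x) + (x 0 k - a) * g x.
Proof.
move=> su; pose F := u - (u \o hproj).
have sF : smooth F by apply: smoothB => //; exact: smooth_hproj.
have fF : flat 1 F.
  by case=> // x _ xk; rewrite /= /F !fctE hproj_id// subrr.
exists (hquot 1 F) => [|x]; first exact: smooth_hquot.
rewrite /hquot; case: eqP => xk; first by rewrite xk subrr mul0r addr0 hproj_id.
rewrite expr1 mulrC divfK ?subr_eq0; last exact/eqP.
by rewrite /F !fctE [RHS]addrC subrK.
Qed.

End HyperplaneDivision.

(** * Superderivations *)

Section GrassmannParity.
Variables (n : nat) (A : comPzRingType).
Implicit Types (f g : grassmann n A) (I J K : {set 'I_n}) (p q b : bool).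

(** Each pair in I x J is inverted in exactly one of the two orders. *)
Lemma inversions_swap I J : [disjoint I & J] ->
  (inversions I J + inversions J I)%N = (#|I| * #|J|)%N.
Proof.
move=> dIJ; rewrite /inversions [X in (_ + X)%N]exchange_big -big_split/=.
rewrite -sum_nat_const; apply: eq_bigr => i iI.
rewrite -big_split/= -sum1_card; apply: eq_bigr => j jJ.
case: (ltngtP i j) => // /val_inj ij.
by move: jJ; rewrite -ij (disjointFr dIJ).
Qed.

Lemma gmulE f g K : (f * g) K = \sum_(I : {set 'I_n} | I \subset K)
  (-1) ^+ inversions I (K :\: I) * (f I * g (K :\: I)).
Proof. by rewrite ffunE. Qed.

Lemma gsignE b f I : ((-1) ^+ b * f) I = (-1) ^+ b * f I.
Proof. by case: b; rewrite ?mulN1r ?mul1r// ffunE. Qed.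

Lemma gconst_mulE u f I : (gconst n u * f) I = u * f I.
Proof.
rewrite gmulE (bigD1 finset.set0) ?finset.sub0set//= big1 => [|J /andP[_ /negPf J0]].
  by rewrite ffunE eqxx inversions0l finset.setD0 mul1r addr0.
by rewrite ffunE J0 mul0r mulr0.
Qed.

Lemma gconst_mulC u f : gconst n u * f = f * gconst n u.
Proof.
apply/ffunP => I; rewrite gconst_mulE gmulE (bigD1 I)//= big1 => [|J /andP[JI nJI]].
  by rewrite ffunE finset.setDv eqxx inversions0r mul1r addr0 mulrC.
rewrite ffunE finset.setD_eq0 (negPf (_ : ~~ (I \subset J))) ?mulr0//.
by apply: contra nJI => IJ; rewrite finset.eqEsubset JI.
Qed.

Lemma homogeneousD p f g : homogeneous p f -> homogeneous p g -> homogeneous p (f + g).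
Proof. by move=> hf hg I Ip; rewrite ffunE hf// hg// addr0. Qed.

Lemma homogeneousN p f : homogeneous p f -> homogeneous p (- f).
Proof. by move=> hf I Ip; rewrite ffunE hf// oppr0. Qed.

Lemma homogeneous0 p : @homogeneous n A p 0.
Proof. by move=> I _; rewrite ffunE. Qed.

Lemma homogeneous_sum p (T : finType) (F : T -> grassmann n A) :
  (forall i, homogeneous p (F i)) -> homogeneous p (\sum_i F i).
Proof.
by move=> hF; elim/big_ind: _ => //; [exact: homogeneous0|exact: homogeneousD].
Qed.

Lemma homogeneous_sign p b f : homogeneous p f -> homogeneous p ((-1) ^+ b * f).
Proof. by move=> hf I Ip; rewrite gsignE hf// mulr0. Qed.

Lemma homogeneous_gconst u : @homogeneous n A false (gconst n u).
Proof.
by move=> I; rewrite ffunE; case: (I =P _) => // ->; rewrite finset.cards0.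
Qed.

Lemma homogeneous_theta j : @homogeneous n A true (theta A j).
Proof.
by move=> I; rewrite ffunE; case: (I =P _) => // ->; rewrite finset.cards1.
Qed.

Lemma odd_cardD I K : I \subset K -> odd #|K| = odd #|I| (+) odd #|K :\: I|.
Proof.
by move=> IK; rewrite -(finset.cardsID I K) (finset.setIidPr IK) oddD.
Qed.

Lemma homogeneousM p q f g : homogeneous p f -> homogeneous q g ->
  homogeneous (p (+) q) (f * g).
Proof.
move=> hf hg K Kpq; rewrite gmulE big1// => I IK.
have [Ip|Ip] := eqVneq (odd #|I|) p; last by rewrite hf// mul0r mulr0.
rewrite hg ?mulr0//; apply: contra Kpq => /eqP Iq.
by rewrite (odd_cardD IK) Ip Iq.
Qed.

(** Complementation in K exchanges the two expansions. By [inversions_swap] their signs differ by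
    the product of the two cardinals, whose parity is [p && q] whenever both coefficients are
    nonzero. *)
Lemma supercommutative p q f g : homogeneous p f -> homogeneous q g ->
  f * g = (-1) ^+ (p && q) * (g * f).
Proof.
move=> hf hg; apply/ffunP => K; rewrite gsignE !gmulE mulr_sumr.
rewrite (reindex_onto (fun I => K :\: I) (fun I => K :\: I))/=; last first.
  by move=> I IK; rewrite finset.setDDr finset.setDv finset.set0U; apply/finset.setIidPr.
have DDE I : (K :\: (K :\: I) == I) = (I \subset K).
  by rewrite finset.setDDr finset.setDv finset.set0U; exact/eqP/finset.setIidPr.
apply: eq_big => [I|I /andP[_]]; first by rewrite DDE finset.subsetDl.
rewrite DDE => IK; rewrite (eqP (_ : K :\: (K :\: I) == I)) ?DDE//.
have [Ip|Ip] := eqVneq (odd #|K :\: I|) p; last by rewrite hf// mul0r !(mulr0, mul0r).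
have [Iq|Iq] := eqVneq (odd #|I|) q; last by rewrite hg// !(mulr0, mul0r).
rewrite [RHS]mulrA [g _ * _]mulrC; congr (_ * _).
have dKI : [disjoint K :\: I & I].
  by rewrite finset.disjoints_subset finset.setDE finset.subsetIr.
rewrite -signr_odd -[X in _ * X]signr_odd -signr_addb; congr (_ ^+ nat_of_bool _).
have := congr1 odd (inversions_swap dKI); rewrite oddD oddM Ip Iq => <-.
by rewrite -addbA addbb addbF.
Qed.

Lemma gpartD p f g : gpart p (f + g) = gpart p f + gpart p g.
Proof.
by apply/ffunP => I; rewrite !ffunE; case: ifP; rewrite ?addr0.
Qed.

Lemma homogeneous_gpart p f : homogeneous p (gpart p f).
Proof. by move=> I /negPf Ip; rewrite ffunE Ip. Qed.

Lemma gpart_id p f : homogeneous p f -> gpart p f = f.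
Proof.
by move=> hf; apply/ffunP => I; rewrite ffunE; case: eqP => // /eqP/hf ->.
Qed.

Lemma gpart_neq p q f : homogeneous q f -> p != q -> gpart p f = 0.
Proof.
move=> hf pq; apply/ffunP => I; rewrite !ffunE; case: eqP => // Ip.
by rewrite hf// Ip.
Qed.

Lemma gpart_sum f : f = gpart false f + gpart true f.
Proof.
apply/ffunP => I; rewrite !ffunE.
by case: (odd _); rewrite /= ?add0r ?addr0.
Qed.

Lemma homogeneous_add_eq0 f g : homogeneous false f -> homogeneous true g ->
  f + g = 0 -> f = 0 /\ g = 0.
Proof.
move=> hf hg fg0.
have gp p : gpart p f + gpart p g = 0.
  by rewrite -gpartD fg0; apply/ffunP => I; rewrite !ffunE; case: ifP.
have := gp false; have := gp true.
rewrite (gpart_id hf) (gpart_id hg) (gpart_neq hf)// (gpart_neq hg)//.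
by rewrite add0r addr0.
Qed.

End GrassmannParity.

(** * Sign identities behind the graded Leibniz rules *)

Section SignRules.
Variable S : pzRingType.
Implicit Types x y : S.

Lemma mulr_signCA (b : nat) x y : x * ((-1) ^+ b * y) = (-1) ^+ b * (x * y).
Proof. by rewrite mulrA (commr_sign x) -mulrA. Qed.

Lemma signr_mul (b c : bool) x : (-1) ^+ b * ((-1) ^+ c * x) = (-1) ^+ (b (+) c) * x.
Proof. by rewrite signr_addb mulrA. Qed.

(** Leibniz rule for the operator g X, with X of parity p, g of parity r and f of parity s: the sign
    grows by [s && r] when g moves past f. *)
Lemma mull_leibniz (p r s : bool) (f g h Xf Xh : S) :
  f * g = (-1) ^+ (s && r) * (g * f) ->
  g * (Xf * h + (-1) ^+ (p && s) * (f * Xh)) =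
  g * Xf * h + (-1) ^+ ((r (+) p) && s) * (f * (g * Xh)).
Proof.
move=> fg; rewrite mulrDr (mulrA g Xf); congr (_ + _).
rewrite (mulrA f g) fg -(mulrA _ _ Xh) mulr_signCA signr_mul (mulrA g).
by congr ((-1) ^+ nat_of_bool _ * _); case: (r) (p) (s) => [] [] [].
Qed.

(** Leibniz rule for the graded commutator, where [XYf] stands for X(Y(f)) and so on. The terms in
    which X and Y hit different factors occur in both orders with the same sign and cancel. *)
Lemma sbracket_leibniz (p q s : bool) (f g Xf Yf Xg Yg XYf YXf XYg YXg : S) :
  XYf * g + (-1) ^+ (p && (s (+) q)) * (Yf * Xg) +
    (-1) ^+ (q && s) * (Xf * Yg + (-1) ^+ (p && s) * (f * XYg)) -
  (-1) ^+ (p && q) * (YXf * g + (-1) ^+ (q && (s (+) p)) * (Xf * Yg) +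
    (-1) ^+ (p && s) * (Yf * Xg + (-1) ^+ (q && s) * (f * YXg))) =
  (XYf - (-1) ^+ (p && q) * YXf) * g +
    (-1) ^+ ((p (+) q) && s) * (f * (XYg - (-1) ^+ (p && q) * YXg)).
Proof.
rewrite mulrBl mulrBr mulr_signCA -!(mulrA _ _ g) !mulrDr.
rewrite mulrN !signr_mul.
have -> : p && (s (+) q) = p && q (+) p && s by case: (p) (q) (s) => [] [] [].
have -> : p && q (+) q && (s (+) p) = q && s by case: (p) (q) (s) => [] [] [].
have -> : q && s (+) p && s = (p (+) q) && s by case: (p) (q) (s) => [] [] [].
have -> : p && q (+) p && s (+) q && s = (p (+) q) && s (+) p && q.
  by case: (p) (q) (s) => [] [] [].
move: (XYf * g) (_ * (Yf * Xg)) (_ * (Xf * Yg)) (_ * (f * XYg)) (_ * (YXf * g)) (_ * (f * YXg)).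
move=> a b c d e h; apply/eqP; rewrite subr_eq [X in _ == X]addrACA.
have -> : a - e + (e + c) = a + c by rewrite addrA subrK.
have -> : d - h + (b + h) = b + d by rewrite [b + h]addrC addrA subrK addrC.
by rewrite addrACA.
Qed.

End SignRules.

(** * Closure properties of superderivations, and the even partial derivatives *)

Section Superderivations.
Variables (R : realType) (l n : nat).
Local Notation SF := (superfun R l n).
Local Notation C := (smoothfun R (l + l)).
Implicit Types (f g : SF) (p q r : bool) (X Y T : SF -> SF) (u v : C).

Lemma smoothfunP u v : (forall x, u x = v x) -> u = v.
Proof. by move=> uv; apply: val_inj; apply/funext. Qed.

Lemma sf_scalerAl (a : R) f g : (a *: f) * g = a *: (f * g).
Proof.
apply/ffunP => K; rewrite [RHS]ffunE !gmulE scaler_sumr; apply: eq_bigr => I _.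
rewrite ffunE; apply: smoothfunP => x.
by rewrite /= !fctE /GRing.scale /= -[in LHS]mulrA [RHS]mulrCA.
Qed.

Lemma sf_scalerAr (a : R) f g : f * (a *: g) = a *: (f * g).
Proof.
apply/ffunP => K; rewrite [RHS]ffunE !gmulE scaler_sumr; apply: eq_bigr => I _.
rewrite ffunE; apply: smoothfunP => x.
by rewrite /= !fctE /GRing.scale /= [X in _ * X]mulrCA [RHS]mulrCA.
Qed.

Lemma homogeneousZ p (a : R) f : homogeneous p f -> homogeneous p (a *: f).
Proof. by move=> hf I Ip; rewrite ffunE hf// scaler0. Qed.

Section Consequences.
Variables (p : bool) (X : SF -> SF) (dX : superderivation p X).

Lemma sderD f g : X (f + g) = X f + X g.
Proof. by case: dX => lX _ _; rewrite -[f]scale1r lX !scale1r. Qed.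

Lemma sder0 : X 0 = 0.
Proof. by apply: (@addrI _ (X 0)); rewrite -sderD !addr0. Qed.

Lemma sderZ (a : R) f : X (a *: f) = a *: X f.
Proof. by case: dX => lX _ _; rewrite -[_ *: f]addr0 lX sder0 addr0. Qed.

Lemma sderN f : X (- f) = - X f.
Proof. by rewrite -scaleN1r sderZ scaleN1r. Qed.

Lemma sderB f g : X (f - g) = X f - X g.
Proof. by rewrite sderD sderN. Qed.

Lemma sder_sum (I : finType) (F : I -> SF) : X (\sum_i F i) = \sum_i X (F i).
Proof. exact: (big_morph X sderD sder0). Qed.

Lemma sder_sign (b : bool) f : X ((-1) ^+ b * f) = (-1) ^+ b * X f.
Proof. by case: b; rewrite ?mulN1r ?mul1r// sderN. Qed.

Lemma sder_homog q f : homogeneous q f -> homogeneous (q (+) p) (X f).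
Proof. by case: dX => _ + _; exact. Qed.

Lemma sderM q f g : homogeneous q f ->
  X (f * g) = X f * g + (-1) ^+ (p && q) * (f * X g).
Proof. by case: dX => _ _; exact. Qed.

Lemma sder1 : X 1 = 0.
Proof.
have h1 : @homogeneous n C false 1.
  by move=> I; rewrite ffunE; case: (I =P _) => // ->; rewrite finset.cards0.
have := sderM 1 h1; rewrite andbF expr0 !mul1r mulr1 => /eqP.
by rewrite eq_sym -subr_eq0 addrK => /eqP.
Qed.

End Consequences.

Lemma sder_ext p X Y : (forall f, X f = Y f) -> superderivation p X -> superderivation p Y.
Proof. by move=> /funext ->. Qed.

Lemma superderivationD p X Y : superderivation p X -> superderivation p Y ->
  superderivation p (fun f => X f + Y f).
Proof.
move=> dX dY; split=> [a f g|q f hf|q f g hf].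
- by rewrite (sderD dX) (sderD dY) (sderZ dX) (sderZ dY) scalerDr addrACA.
- by apply: homogeneousD; [exact: (sder_homog dX)|exact: (sder_homog dY)].
- by rewrite (sderM dX _ hf) (sderM dY _ hf) addrACA mulrDl !mulrDr.
Qed.

Lemma superderivation_sum p (I : finType) (F : I -> SF -> SF) :
  (forall i, superderivation p (F i)) -> superderivation p (fun f => \sum_i F i f).
Proof.
move=> dF; split=> [a f g|q f hf|q f g hf].
- rewrite scaler_sumr -big_split; apply: eq_bigr => i _.
  by rewrite (sderD (dF i)) (sderZ (dF i)).
- by apply: homogeneous_sum => i; exact: (sder_homog (dF i)).
- rewrite mulr_suml !mulr_sumr -big_split; apply: eq_bigr => i _.
  by rewrite (sderM (dF i) _ hf).
Qed.

Lemma superderivationMl p q r g X : homogeneous r g -> superderivation p X ->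
  q = r (+) p -> superderivation q (fun f => g * X f).
Proof.
move=> hg dX ->; split=> [a f f'|s f hf|s f f' hf].
- by rewrite (sderD dX) (sderZ dX) mulrDr sf_scalerAr.
- rewrite addbCA; apply: homogeneousM hg _.
  exact: (sder_homog dX).
- rewrite (sderM dX _ hf).
  exact: (@mull_leibniz SF p r s f g f' (X f) (X f') (supercommutative hf hg)).
Qed.

Lemma superderivationZ p (a : R) X : superderivation p X ->
  superderivation p (fun f => a *: X f).
Proof.
move=> dX; split=> [b f g|s f hf|s f f' hf].
- by rewrite (sderD dX) (sderZ dX) scalerDr !scalerA mulrC.
- by apply: homogeneousZ; exact: (sder_homog dX).
- by rewrite (sderM dX _ hf) scalerDr sf_scalerAl !sf_scalerAr.
Qed.

(** The parities are arguments because an operator does not determine its own: the zero operator has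
    both. [bracket] is a sum of such commutators over homogeneous components. *)
Definition sbracket p q X Y : SF -> SF :=
  fun f => X (Y f) - (-1) ^+ (p && q) * Y (X f).

Lemma superderivation_sbracket p q X Y : superderivation p X ->
  superderivation q Y -> superderivation (p (+) q) (sbracket p q X Y).
Proof.
move=> dX dY; rewrite /sbracket; split=> [a f g|s f hf|s f g hf].
- rewrite !((sderD dX, sderD dY), (sderZ dX, sderZ dY)) mulrDr scalerBr sf_scalerAr.
  by rewrite opprD addrACA.
- apply: homogeneousD; last apply: homogeneousN; last apply: homogeneous_sign.
    by rewrite [p (+) q]addbC addbA; do 2![apply: sder_homog => //].
  by rewrite addbA; apply: (sder_homog dY); exact: (sder_homog dX).
- rewrite (sderM dX _ hf) (sderM dY _ hf) (sderD dX) (sderD dY).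
  rewrite (sder_sign dX) (sder_sign dY).
  rewrite (sderM dX _ hf) (sderM dY _ hf).
  rewrite (sderM dX _ (sder_homog dY hf)) (sderM dY _ (sder_homog dX hf)).
  exact: sbracket_leibniz.
Qed.

Lemma spartialD k u v : spartial k (u + v) = spartial k u + spartial k v.
Proof.
apply: smoothfunP => x.
have [_] := is_deriveD (is_derive_partial x k (valP u)) (is_derive_partial x k (valP v)).
exact.
Qed.

Lemma spartialZ k (a : R) u : spartial k (a *: u) = a *: spartial k u.
Proof.
apply: smoothfunP => x.
by have [_] := is_deriveZ a (is_derive_partial x k (valP u)).
Qed.

Lemma spartialM k u v : spartial k (u * v) = spartial k u * v + u * spartial k v.
Proof.
apply: smoothfunP => x.
have [_ E] := is_deriveM (is_derive_partial x k (valP u)) (is_derive_partial x k (valP v)).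
by rewrite [LHS]E addrC [X in X + _]mulrC.
Qed.

Lemma spartial0 k : spartial k (0 : C) = 0.
Proof. by rewrite -[X in spartial k X](scale0r (0 : C)) spartialZ scale0r. Qed.

Lemma superderivation_d_even k : superderivation false (@d_even R l n k).
Proof.
split=> [a f g|q f hf|q f g hf].
- by apply/ffunP => I; rewrite !ffunE spartialD spartialZ.
- by rewrite addbF => I Iq; rewrite ffunE hf// spartial0.
- rewrite mul1r; apply/ffunP => K; rewrite [in RHS]ffunE ffunE !gmulE.
  rewrite (big_morph (spartial k) (@spartialD k) (spartial0 k)) -big_split.
  apply: eq_bigr => I _; rewrite !ffunE /=.
  have sE b w : spartial k ((-1) ^+ b * w) = (-1) ^+ b * spartial k w :> C.
    rewrite -signr_odd; case: (odd b); rewrite ?mul1r//.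
    by rewrite !mulN1r -[- w]scaleN1r spartialZ scaleN1r.
  by rewrite sE spartialM mulrDr.
Qed.

End Superderivations.

(** * The odd partial derivatives are superderivations *)

Section OddDerivative.
Variables (R : realType) (l n : nat) (j : 'I_n).
Local Notation SF := (superfun R l n).
Implicit Types (f g : SF) (I J K L : {set 'I_n}).
Local Notation inv1 := (inversions (finset.set1 j)).

Lemma inversionsU1l I L : j \notin I ->
  inversions (j |: I)%SET L = (inv1 L + inversions I L)%N.
Proof. by move=> jI; rewrite inversionsUl// finset.disjoints1. Qed.

Lemma inversionsU1r I L : j \notin L ->
  inversions I (j |: L)%SET = (inversions I (finset.set1 j) + inversions I L)%N.
Proof. by move=> jL; rewrite inversionsUr// finset.disjoints1. Qed.

Lemma inversions1_swap I : j \notin I ->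
  (inv1 I + inversions I (finset.set1 j))%N = #|I|.
Proof.
by move=> jI; rewrite inversions_swap ?finset.disjoints1// finset.cards1 mul1n.
Qed.

Lemma inversions_split I K : I \subset K -> inv1 K = (inv1 I + inv1 (K :\: I))%N.
Proof.
move=> IK; rewrite -inversionsUr; last first.
  by rewrite disjoint_sym finset.disjoints_subset finset.setDE finset.subsetIr.
by rewrite -[in LHS](finset.setID K I) (finset.setIidPr IK).
Qed.

Lemma gsum_split1 (V : nmodType) (F : {set 'I_n} -> V) K : j \in K ->
  \sum_(I : {set 'I_n} | I \subset K) F I =
  \sum_(I : {set 'I_n} | I \subset K :\ j) F (j |: I)%SET +
  \sum_(I : {set 'I_n} | I \subset K :\ j) F I.
Proof.
move=> jK; rewrite (bigID (fun I : {set 'I_n} => j \in I))/=; congr (_ + _).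
  rewrite (reindex_onto (fun I => j |: I)%SET (fun I => I :\ j))/=; last first.
    by move=> I /andP[_ jI]; exact: finset.setD1K.
  apply: eq_bigl => I; rewrite finset.subUset finset.sub1set jK finset.setU11 andbT/=.
  rewrite finset.subsetD1; case: (boolP (j \in I)) => jI.
    by rewrite andbF; apply/negP => /andP[_ /eqP E]; move: jI; rewrite -E !inE eqxx.
  by rewrite finset.setU1K// eqxx.
by apply: eq_bigl => I; rewrite finset.subsetD1.
Qed.

Lemma d_thetaE f I : d_theta j f I =
  if j \in I then 0 else (-1) ^+ inv1 I * f (j |: I)%SET.
Proof. by rewrite ffunE. Qed.

Lemma signr_eq (S : pzRingType) (a b : nat) (x : S) : odd a = odd b ->
  (-1) ^+ a * x = (-1) ^+ b * x.
Proof. by move=> ab; rewrite -signr_odd ab signr_odd. Qed.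

(** The Leibniz rule is checked on each coefficient K, splitting sums over subsets by membership of
    j. By [inversions1_swap], carrying theta_j past theta_I contributes the sign (-1)^|I|, and
    homogeneity of f ties |I| to q. *)
Lemma superderivation_d_theta : superderivation true (@d_theta R l n j).
Proof.
split=> [a f g|q f hf|q f g hf].
- apply/ffunP => I; rewrite !ffunE; case: ifP => _; first by rewrite scaler0 addr0.
  rewrite mulrDr; congr (_ + _); apply: smoothfunP => x.
  by rewrite /= !fctE /GRing.scale /= mulrCA.
- move=> I Iq; rewrite ffunE; case: ifP => // /negbT jI.
  rewrite hf ?mulr0// finset.cardsU1 jI/=.
  by move: Iq; case: (odd _) (q) => [] [].
- apply/ffunP => K; rewrite [RHS]ffunE /= gsignE d_thetaE; case: ifPn => jK.
    (* If j lies in K, the left side has no such coefficient. On the right both surviving sums run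
       over the products of f at [j |: I] and g at [j |: L], with opposite signs. *)
    rewrite !gmulE !(gsum_split1 _ jK).
    rewrite [X in (X + _) + _]big1 => [|I _]; last first.
      by rewrite d_thetaE finset.setU11 mul0r mulr0.
    rewrite [X in _ * (_ + X)]big1 => [|I]; last first.
      by rewrite finset.subsetD1 => /andP[_ jI]; rewrite d_thetaE inE jI jK !mulr0.
    rewrite add0r addr0 mulr_sumr -big_split big1// => I.
    rewrite finset.subsetD1 => /andP[IK jI] /=.
    set L := K :\: (j |: I)%SET.
    have jL : j \notin L by rewrite !inE eqxx.
    have -> : K :\: I = (j |: L)%SET.
      apply/finset.setP => i; rewrite !inE.
      by case: eqP => [->|_]; rewrite ?jI ?jK.
    rewrite !d_thetaE (negPf jI) (negPf jL) inversionsU1l// inversionsU1r//.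
    have [jIq|jIq] := eqVneq (odd #|j |: I|%SET) q; last first.
      by rewrite (hf _ jIq) !(mulr0, mul0r) addr0.
    have := inversions1_swap jI; set a := inversions I _ => aE.
    rewrite finset.cardsU1 jI -aE !oddD in jIq.
    rewrite -!mulrA [f _ * (_ * _)]mulrCA !mulrA -!exprD -!mulrA.
    rewrite [X in _ + X](@signr_eq _ _ (a + inversions I L + inv1 I).+1).
      by rewrite exprS mulN1r mulNr subrr.
    by rewrite /= !oddD -jIq oddb /=; case: (odd _) (odd _) (odd _) (odd _) => [] [] [] [].
  (* If j is not in K, the terms of (f g) at [j |: K] where j falls in the index of f give the first
     summand of the Leibniz rule, and those where it falls in the index of g the second. *)
  rewrite !gmulE (gsum_split1 _ (finset.setU11 j K)) finset.setU1K// mulrDr.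
  rewrite !mulr_sumr; congr (_ + _); apply: eq_bigr => I IK.
    have jI : j \notin I by apply: contra jK; exact: (fintype.subsetP IK).
    have -> : (j |: K)%SET :\: (j |: I)%SET = K :\: I.
      apply/finset.setP => i; rewrite !inE.
      by case: eqP => // ->; rewrite /= (negPf jK) andbF.
    rewrite d_thetaE (negPf jI) inversionsU1l// (inversions_split IK).
    rewrite -!mulrA !mulrA -!exprD -!mulrA; apply: signr_eq.
    by rewrite !oddD; case: (odd _) (odd _) (odd _) => [] [] [].
  have jI : j \notin I by apply: contra jK; exact: (fintype.subsetP IK).
  have jL : j \notin K :\: I by rewrite !inE negb_and jK orbT.
  have -> : (j |: K)%SET :\: I = (j |: (K :\: I))%SET.
    apply/finset.setP => i; rewrite !inE.
    by case: eqP => // ->; rewrite /= jI.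
  rewrite d_thetaE (negPf jL) inversionsU1r// (inversions_split IK).
  have [Iq|Iq] := eqVneq (odd #|I|) q; last by rewrite (hf _ Iq) !(mulr0, mul0r).
  have := inversions1_swap jI; set a := inversions I _ => aE.
  rewrite -aE oddD in Iq.
  rewrite [f _ * (_ * _)]mulrCA !mulrA -!exprD -!mulrA; apply: signr_eq.
  by rewrite !oddD -Iq oddb /=; case: (odd _) (odd _) (odd _) (odd _) => [] [] [] [].
Qed.

End OddDerivative.

(** Induction on a list of coordinates on which the function depends: Hadamard's lemma at x0 removes
    one coordinate without changing L, and a function depending on no coordinate is constant. *)
Lemma smooth_ideal_ind (R : realType) (m : nat) (x0 : 'rV[R]_m.+1)
    (L : smoothfun R m -> R) :
  (forall (u v g : smoothfun R m) k, (forall x, u x = v x + (x 0 k - x0 0 k) * g x) -> L u = L v) ->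
  (forall u : smoothfun R m, (forall x, u x = u x0) -> L u = 0) ->
  forall u, L u = 0.
Proof.
move=> Lmod Lcst u.
have supp (s : seq 'I_m.+1) : forall v : smoothfun R m,
    (forall x y : 'rV[R]_m.+1, (forall k, k \in s -> x 0 k = y 0 k) -> v x = v y) -> L v = 0.
  elim: s => [|k s IH] v vs; first by apply: Lcst => x; exact: vs.
  have [g sg vE] := @hadamard _ _ k (x0 0 k) v (valP v).
  pose w := SmoothFun (smooth_hproj k (x0 0 k) (valP v)).
  rewrite (Lmod v w (SmoothFun sg) k)//; apply: IH => x y xy.
  apply: vs => i; rewrite inE !hprojE.
  by case: (eqVneq i k) => //= _; exact: xy.
apply: (supp (enum 'I_m.+1)) => x y xy; congr (u _).
by apply/rowP => k; apply: xy; rewrite mem_enum.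
Qed.

(** * A superderivation is determined by its values on the coordinates *)

Section CoordinateExpansion.
Variables (R : realType) (l n : nat).
Local Notation SF := (superfun R l n).
Local Notation C := (smoothfun R (l + l)).
Implicit Types (f g : SF) (p q r : bool) (X Y T : SF -> SF) (u v : C).

Lemma gconst_linear (a : R) u v : gconst n (a *: u + v) = a *: gconst n u + gconst n v.
Proof.
by apply/ffunP => I; rewrite !ffunE; case: eqP; rewrite ?scaler0 ?addr0.
Qed.

Lemma gaddE f g (I : {set 'I_n}) : (f + g) I = f I + g I.
Proof. by rewrite ffunE. Qed.

Lemma gconst1 : gconst n (1 : C) = 1.
Proof. by apply/ffunP => I; rewrite !ffunE; case: eqP. Qed.

(** The monomial theta_I, with its factors in increasing order. *)
Definition gmono (I : {set 'I_n}) : SF := [ffun J => (J == I)%:R].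

Lemma gmono0 : gmono finset.set0 = 1.
Proof. by apply/ffunP => I; rewrite !ffunE. Qed.

Lemma gmono_expand f : f = \sum_I gconst n (f I) * gmono I.
Proof.
apply/ffunP => J; rewrite sum_ffunE (bigD1 J)//= gconst_mulE ffunE eqxx mulr1.
rewrite big1 ?addr0// => I IJ; rewrite gconst_mulE ffunE eq_sym (negPf IJ).
by rewrite mulr0.
Qed.

Lemma theta_gmono (j : 'I_n) (J : {set 'I_n}) : j \notin J ->
  gmono (j |: J)%SET = (-1) ^+ odd (inversions (finset.set1 j) J) * (thetac R l j * gmono J).
Proof.
move=> jJ; apply/ffunP => K; rewrite gsignE signr_odd gmulE ffunE.
have [jK|jK] := boolP (j \in K); last first.
  rewrite big1 => [|I IK].
    rewrite mulr0; case: eqP => // KE; by move: jK; rewrite KE !inE eqxx.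
  rewrite !ffunE; case: (I =P _) => IE; last by rewrite mul0r mulr0.
  by move: jK; rewrite (fintype.subsetP IK)// IE !inE eqxx.
rewrite (bigD1 (finset.set1 j)) ?finset.sub1set//= big1 => [|I /andP[_ /negPf Ij]]; last first.
  by rewrite ffunE Ij mul0r mulr0.
rewrite !ffunE eqxx mul1r addr0; case: (K =P _) => KE.
  by rewrite KE finset.setU1K// eqxx mulr1 -expr2 sqrr_sign.
case: (_ =P J) => KJ; last by rewrite !mulr0.
by case: KE; rewrite -KJ finset.setD1K.
Qed.

Lemma sder_eq0 p X : superderivation p X ->
  (forall k, X (coord_even R n k) = 0) -> (forall j, X (thetac R l j) = 0) ->
  forall f, X f = 0.
Proof.
move=> dX Xe Xo.
have Xmono I : X (gmono I) = 0.
  move: {2}#|I| (leqnn #|I|) => N; elim: N I => [|N IH] I.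
    by rewrite leqn0 finset.cards_eq0 => /eqP ->; rewrite gmono0 (sder1 dX).
  have [->|[j jI]] := finset.set_0Vmem I; first by rewrite gmono0 (sder1 dX).
  rewrite -(finset.setD1K jI) finset.cardsU1 !inE eqxx/= ltnS => IN.
  rewrite theta_gmono ?inE ?eqxx// (sder_sign dX) (sderM dX _ (homogeneous_theta _ j)).
  by rewrite (IH _ IN) Xo mul0r !mulr0 addr0 mulr0.
have Xconst u : X (gconst n u) = 0.
  apply/ffunP => I; rewrite [RHS]ffunE; apply: smoothfunP => x0.
  (* One coefficient at one point is a functional to which [smooth_ideal_ind] applies. With w = x_k
     - x0_k, X kills w, so adding w g to u adds w X(g) to X(u), and this vanishes at x0. *)
  pose L u : R := X (gconst n u) I x0.
  apply: (@smooth_ideal_ind _ _ x0 L) => {u} [u v g k uE|u uE]; rewrite /L.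
    pose w : C := (- x0 0 k) *: (1 : C) + scoord R k.
    have uvw : gconst n u = 1 *: gconst n v + gconst n w * gconst n g.
      apply/ffunP => J; rewrite gaddE gconst_mulE !ffunE.
      case: eqP => _; last by rewrite scaler0 mulr0 addr0.
      apply: smoothfunP => x; rewrite uE /= !fctE /GRing.scale /= mul1r mulr1.
      by rewrite [_ + x 0 k]addrC.
    have Xw : X (gconst n w) = 0.
      rewrite /w gconst_linear gconst1 (sderD dX) (sderZ dX) (sder1 dX) scaler0 add0r.
      exact: Xe.
    have -> : X (gconst n u) = X (gconst n v) + gconst n w * X (gconst n g).
      rewrite uvw (sderD dX) (sderZ dX) scale1r (sderM dX _ (homogeneous_gconst w)).
      by rewrite Xw mul0r add0r andbF expr0 mul1r.
    rewrite gaddE gconst_mulE /= !fctE /GRing.scale /= mulr1.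
    by rewrite addNr mul0r addr0.
  have -> : gconst n u = u x0 *: (1 : SF).
    rewrite -gconst1; apply/ffunP => J; rewrite !ffunE.
    case: eqP => _; last by rewrite scaler0.
    by apply: smoothfunP => x; rewrite uE /= !fctE /GRing.scale /= mulr1.
  by rewrite (sderZ dX) (sder1 dX) scaler0 ffunE.
move=> f; rewrite [f]gmono_expand (sder_sum dX) big1// => I _.
by rewrite (sderM dX _ (homogeneous_gconst _)) Xconst Xmono mul0r !mulr0 addr0.
Qed.

Lemma d_even_coord k i : @d_even R l n k (coord_even R n i) = (k == i)%:R :> SF.
Proof.
apply/ffunP => I; rewrite !ffunE; case: eqP => [->|IE]; last first.
  by rewrite spartial0; case: eqP => _; rewrite ffunE// (introF eqP IE).
have -> : spartial k (scoord R i) = (k == i)%:R.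
  apply: smoothfunP => x; rewrite /= /partial.
  have [_ ->] := is_derive_coord i x (delta_mx 0 k).
  by rewrite mxE eqxx eq_sym; case: eqP.
by case: eqP => _; rewrite !ffunE ?eqxx.
Qed.

Lemma d_even_theta k j : @d_even R l n k (thetac R l j) = 0.
Proof.
apply/ffunP => I; rewrite !ffunE; case: eqP => _; last exact: spartial0.
by apply: smoothfunP => x; rewrite /= /partial derive_cst.
Qed.

Lemma d_theta_coord k j : @d_theta R l n j (coord_even R n k) = 0.
Proof.
apply/ffunP => I; rewrite !ffunE; case: ifP => // _.
case: eqP => [IE|_]; last by rewrite mulr0.
by have := finset.setU11 j I; rewrite IE inE.
Qed.

Lemma d_theta_theta j i : @d_theta R l n j (thetac R l i) = (j == i)%:R.
Proof.
apply/ffunP => I; rewrite !ffunE; case: ifPn => jI.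
  case: eqP => _; rewrite ffunE//; case: eqP => // IE.
  by move: jI; rewrite IE inE.
have -> : ((j |: I)%SET == finset.set1 i) = (j == i) && (I == finset.set0).
  apply/eqP/andP => [E|[/eqP -> /eqP ->]]; last by rewrite finset.setU0.
  have := finset.setU11 j I; rewrite E inE => ji; split=> //.
  rewrite -finset.subset0; apply/fintype.subsetP => k kI.
  have : k \in (j |: I)%SET by rewrite !inE kI orbT.
  by rewrite E inE -(eqP ji) => /eqP kj; rewrite -kj kI in jI.
case: (j =P i) => _; rewrite ffunE ?mulr0//=.
by case: eqP => [->|_]; rewrite ?inversions0r ?mulr1 ?mulr0.
Qed.

(** The right side Y is a superderivation of the same parity that agrees with X on the coordinates,
    so [sder_eq0] applies to X - Y. *)
Lemma superderivation_expand p X f : superderivation p X ->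
  X f = \sum_k X (coord_even R n k) * d_even k f + \sum_j X (thetac R l j) * d_theta j f.
Proof.
move=> dX; pose Y g := (\sum_k X (coord_even R n k) * d_even k g
  + \sum_j X (thetac R l j) * d_theta j g).
have dY : superderivation p Y.
  apply: superderivationD; apply: superderivation_sum => i.
    apply: (superderivationMl _ (superderivation_d_even R n i)).
      by apply: (sder_homog dX); exact: homogeneous_gconst.
    by rewrite addbF.
  apply: (superderivationMl _ (superderivation_d_theta R l i)).
    by apply: (sder_homog dX); exact: homogeneous_theta.
  by rewrite addbT negbK.
have dZ : superderivation p (fun g => X g + (-1) *: Y g).
  exact: (superderivationD dX (superderivationZ (-1) dY)).
apply/eqP; rewrite -subr_eq0 -scaleN1r; apply/eqP.
apply: (sder_eq0 dZ) => [k|j]; rewrite /Y scaleN1r.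
  rewrite (bigD1 k)//= d_even_coord eqxx mulr1 big1 => [|i /negPf ik].
    rewrite big1 ?addr0 ?subrr// => i _; by rewrite d_theta_coord mulr0.
  by rewrite d_even_coord ik mulr0.
rewrite big1 => [|i _]; last by rewrite d_even_theta mulr0.
rewrite (bigD1 j)//= d_theta_theta eqxx mulr1 big1 ?addr0 ?add0r ?subrr// => i /negPf ij.
by rewrite d_theta_theta ij mulr0.
Qed.

End CoordinateExpansion.

(** * Contact vector fields *)

Section ContactIdentities.
Variables (S : pzRingType) (l n : nat).

(** Change of frame from the partial derivatives to d_z and the T_s: the multiples of d_z inside the
    T_s are compensated by the coefficient of d_z becoming alpha(X). Only the even coordinates have
    to commute with values of X. *)
Lemma frame_identity (Xz dz : S) (x y Xx Xy dx dy : 'I_l -> S) (t Xt dt : 'I_n -> S) :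
  (forall i, x i * Xy i = Xy i * x i) -> (forall i, y i * Xx i = Xx i * y i) ->
  (Xz * dz + (\sum_i Xx i * dx i + \sum_i Xy i * dy i)) + \sum_j Xt j * dt j =
  (Xz + \sum_i (x i * Xy i - y i * Xx i) + \sum_j Xt j * t j) * dz +
  (\sum_i Xx i * (dx i + y i * dz) + \sum_i Xy i * (dy i - x i * dz) +
   \sum_j Xt j * (dt j - t j * dz)).
Proof.
move=> xX yX.
have -> : \sum_i Xx i * (dx i + y i * dz) = \sum_i Xx i * dx i + (\sum_i y i * Xx i) * dz.
  rewrite mulr_suml -big_split; apply: eq_bigr => i _.
  by rewrite mulrDr yX mulrA.
have -> : \sum_i Xy i * (dy i - x i * dz) = \sum_i Xy i * dy i - (\sum_i x i * Xy i) * dz.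
  rewrite mulr_suml -sumrB; apply: eq_bigr => i _.
  by rewrite mulrBr xX mulrA.
have -> : \sum_j Xt j * (dt j - t j * dz) = \sum_j Xt j * dt j - (\sum_j Xt j * t j) * dz.
  rewrite mulr_suml -sumrB; apply: eq_bigr => j _.
  by rewrite mulrBr mulrA.
rewrite sumrB !mulrDl mulNr.
move: (Xz * dz) (_ * dz) (_ * dz) (_ * dz) (\sum_i _) (\sum_i _) (\sum_i _).
move=> d c b h e g f; rewrite !addrA [RHS](ACl (1*5*7*9*2*8*3*6*4*10))/=.
by rewrite !(addrK, subrK).
Qed.

(** Contribution of one pair x_i, y_i, where A and B are T_{x_i} f and T_{y_i} f for f = alpha(X).
    The doubled products arise because reordering the Leibniz terms of T(alpha(X)) yields those of
    X(alpha(T)) again. *)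
Lemma even_contact_identity (s : bool) (x y XTx XTy TXx TXy Xx Xy Tx Ty A B : S) :
  Tx * Xy = (-1) ^+ s * (Xy * Tx) -> Ty * Xx = (-1) ^+ s * (Xx * Ty) ->
  Tx * A = (-1) ^+ s * (A * Tx) -> Ty * B = (-1) ^+ s * (B * Ty) ->
  (x * (XTy - (-1) ^+ s * TXy) - y * (XTx - (-1) ^+ s * TXx)) -
    ((Xy *+ 2 - A) * Tx - (Xx *+ 2 + B) * Ty) =
  ((Xx * Ty + x * XTy) - (Xy * Tx + y * XTx)) -
   (-1) ^+ s * (((Tx * Xy + x * TXy) - (Ty * Xx + y * TXx)) - (Tx * A + Ty * B)).
Proof.
move=> -> -> -> ->.
rewrite !mulr2n !(mulrBr, mulrDr, mulrBl, mulrDl) !signr_mul !addbb !mul1r !mulr_signCA.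
rewrite !(opprD, opprK, addrA).
by rewrite [LHS](ACl (8*1*5*3*6*2*9*4*7*10)).
Qed.

(** Contribution of one theta_j, where D is T_{theta_j} f. As theta_j stands on the right in alpha,
    the Leibniz signs, the reordering and the sign of the commutator combine to -(-1)^q X(theta_j)
    T(theta_j) from each side. *)
Lemma odd_contact_identity (p q : bool) (t XTt TXt Xt Tt D : S) :
  Tt * Xt = (-1) ^+ (~~ q && ~~ p) * (Xt * Tt) ->
  Tt * D = (-1) ^+ (~~ q && ~~ p) * (D * Tt) ->
  (XTt - (-1) ^+ (p && q) * TXt) * t - (-1) ^+ q * ((Xt *+ 2 + (-1) ^+ p * D) * Tt) =
  (XTt * t + (-1) ^+ (p && ~~ q) * (Tt * Xt)) -
  (-1) ^+ (p && q) * ((TXt * t + (-1) ^+ (q && ~~ p) * (Xt * Tt)) - Tt * D).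
Proof.
move=> -> ->.
rewrite !mulr2n !(mulrBr, mulrDr, mulrBl, mulrDl) -!(mulrA _ _ Tt) -!(mulrA _ _ t) !signr_mul.
case: p q => [] [] /=; rewrite ?(expr0, expr1, mul1r, mulN1r, opprD, opprK, addrA).
all: by congr (_ + _ + _); rewrite addrAC.
Qed.

(** Assembly of the summands: P1, Q1 come from X(alpha(T)) = 0, P2, Q2 from T(alpha(X)), P3, Q3 from
    the frame expansion of T applied to alpha(X), P0, Q0 from alpha([X, T]), and P, Q from the
    bracket formula. *)
Lemma contact_sum_identity (e Z1 Z2 : S) (P0 P P1 P2 P3 : 'I_l -> S) (Q0 Q Q1 Q2 Q3 : 'I_n -> S) :
  (forall i, P0 i - P i = P1 i - e * (P2 i - P3 i)) ->
  (forall j, Q0 j - Q j = Q1 j - e * (Q2 j - Q3 j)) ->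
  Z1 + \sum_i P1 i + \sum_j Q1 j = 0 ->
  Z2 + \sum_i P2 i + \sum_j Q2 j = \sum_i P3 i + \sum_j Q3 j ->
  Z1 - e * Z2 + \sum_i P0 i + \sum_j Q0 j = \sum_i P i + \sum_j Q j.
Proof.
have lin k (F0 F F1 F2 F3 : 'I_k -> S) : (forall i, F0 i - F i = F1 i - e * (F2 i - F3 i)) ->
    \sum_i F0 i = \sum_i F i + (\sum_i F1 i - e * (\sum_i F2 i - \sum_i F3 i)).
  move=> FE; rewrite -!sumrB mulr_sumr -sumrB -big_split; apply: eq_bigr => i _.
  by rewrite -FE [RHS]addrC subrK.
move=> /lin -> /lin ->; move: (\sum_i _) (\sum_i _) (\sum_i _) (\sum_i _) => a2 b2 b1 a1.
move: (\sum_i _) (\sum_i _) (\sum_i _) (\sum_i _) => b a b3 a3 Z1E Z2E.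
transitivity (a + b + (Z1 + a1 + b1) - (e * (Z2 + b2 + a2) - e * (a3 + b3))).
  rewrite !mulrBr !mulrDr !opprD !opprK !addrA.
  by rewrite [LHS](ACl (3*7*1*4*8*2*5*9*6*10)).
by rewrite Z1E Z2E subrr subr0 addr0.
Qed.

End ContactIdentities.

(** * The frame T_s and the contact form of a bracket *)

Section ContactFields.
Variables (R : realType) (l n : nat).
Local Notation SF := (superfun R l n).
Implicit Types (f g : SF) (p q : bool) (X Y T : SF -> SF) (r s : 'I_(l + l + n)).

(** [fx], [fy] and [ft] place the three blocks x, y, theta in the range of frame indices, in the
    order used by [omega]. *)
Definition fx (i : 'I_l) : 'I_(l + l + n) := lshift n (lshift l i).
Definition fy (i : 'I_l) : 'I_(l + l + n) := lshift n (rshift l i).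
Definition ft (j : 'I_n) : 'I_(l + l + n) := rshift (l + l) j.

Definition fcoord s : SF :=
  match fintype.split s with
  | inl k => match fintype.split k with inl i => xc R n i | inr i => yc R n i end
  | inr j => thetac R l j
  end.

Lemma split_fx i : fintype.split (fx i) = inl (lshift l i).
Proof. exact: (unsplitK (inl _)). Qed.

Lemma split_fy i : fintype.split (fy i) = inl (rshift l i).
Proof. exact: (unsplitK (inl _)). Qed.

Lemma split_ft j : fintype.split (ft j) = inr j.
Proof. exact: (unsplitK (inr _)). Qed.

Lemma split_lshift i : fintype.split (lshift l i) = inl i :> 'I_l + 'I_l.
Proof. exact: (unsplitK (inl _)). Qed.

Lemma split_rshift i : fintype.split (rshift l i) = inr i :> 'I_l + 'I_l.
Proof. exact: (unsplitK (inr _)). Qed.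

Lemma fcoordE : ((forall i, fcoord (fx i) = xc R n i) *
  (forall i, fcoord (fy i) = yc R n i) * (forall j, fcoord (ft j) = thetac R l j))%type.
Proof.
by split; [split|] => i; rewrite /fcoord ?split_fx ?split_fy ?split_ft ?split_lshift ?split_rshift.
Qed.

Lemma Tfield_fx i f : Tfield (fx i) f = d_x i f + yc R n i * d_z f.
Proof. by rewrite /Tfield split_fx split_lshift. Qed.

Lemma Tfield_fy i f : Tfield (fy i) f = d_y i f - xc R n i * d_z f.
Proof. by rewrite /Tfield split_fy split_rshift. Qed.

Lemma Tfield_ft j f : Tfield (ft j) f = d_theta j f - thetac R l j * d_z f.
Proof. by rewrite /Tfield split_ft. Qed.

Lemma Tparity_fx i : Tparity (fx i) = false.
Proof. by apply/negbTE; rewrite -ltnNge; exact: ltn_ord (lshift l i). Qed.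

Lemma Tparity_fy i : Tparity (fy i) = false.
Proof. by apply/negbTE; rewrite -ltnNge; exact: ltn_ord (rshift l i). Qed.

Lemma Tparity_ft j : Tparity (ft j) = true.
Proof. by rewrite /Tparity leq_addr. Qed.

Lemma frame_ind (P : 'I_(l + l + n) -> Prop) :
  (forall i, P (fx i)) -> (forall i, P (fy i)) -> (forall j, P (ft j)) -> forall s, P s.
Proof.
move=> Px Py Pt s; rewrite -(splitK s); case: (fintype.split s) => [k|j] /=; last exact: Pt.
by rewrite -(splitK k); case: (fintype.split k) => i /=; [exact: Px|exact: Py].
Qed.

Lemma frame_sum (V : nmodType) (F : 'I_(l + l + n) -> V) :
  \sum_s F s = \sum_i F (fx i) + \sum_i F (fy i) + \sum_j F (ft j).
Proof. by rewrite !big_split_ord. Qed.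

Lemma superderivation_Tfield s : superderivation (Tparity s) (@Tfield R l n s).
Proof.
elim/frame_ind: s => i.
- rewrite Tparity_fx; apply: (sder_ext (fun f => esym (Tfield_fx i f))).
  apply: superderivationD; first exact: superderivation_d_even.
  exact: (superderivationMl (homogeneous_gconst _) (superderivation_d_even _ _ _)).
- rewrite Tparity_fy; apply: (sder_ext (X := fun f => d_y i f + (-1) *: (xc R n i * d_z f))).
    by move=> f; rewrite Tfield_fy scaleN1r.
  apply: superderivationD; first exact: superderivation_d_even.
  apply: superderivationZ.
  exact: (superderivationMl (homogeneous_gconst _) (superderivation_d_even _ _ _)).
- rewrite Tparity_ft.
  apply: (sder_ext (X := fun f => d_theta i f + (-1) *: (thetac R l i * d_z f))).
    by move=> f; rewrite Tfield_ft scaleN1r.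
  apply: superderivationD; first exact: superderivation_d_theta.
  apply: superderivationZ.
  exact: (superderivationMl (homogeneous_theta _ _) (superderivation_d_even _ _ _)).
Qed.

Lemma d_z_fcoord s : d_z (fcoord s) = 0.
Proof.
by elim/frame_ind: s => i; rewrite fcoordE /d_z ?d_even_theta// d_even_coord.
Qed.

Lemma Tfield_fcoord r s : Tfield r (fcoord s) = (r == s)%:R.
Proof.
have xyE i i' : (fx i == fy i') = false by apply/negbTE/eqP => /lshift_inj/eqP; rewrite eq_lrshift.
have xtE i j : (fx i == ft j) = false by exact: eq_lrshift.
have ytE i j : (fy i == ft j) = false by exact: eq_lrshift.
have xxE i i' : (fx i == fx i') = (i == i') by rewrite !eq_lshift.
have yyE i i' : (fy i == fy i') = (i == i') by rewrite eq_lshift eq_rshift.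
have ttE j j' : (ft j == ft j') = (j == j') by rewrite eq_rshift.
elim/frame_ind: r => i; rewrite ?Tfield_fx ?Tfield_fy ?Tfield_ft d_z_fcoord mulr0 ?addr0 ?subr0;
  elim/frame_ind: s => k; rewrite fcoordE /d_x /d_y.
all: rewrite ?d_even_theta ?d_theta_coord ?d_theta_theta ?d_even_coord //.
all: rewrite ?xxE ?xyE ?xtE ?yyE ?ytE ?ttE // ?[_ == fx _]eq_sym ?[ft _ == _]eq_sym.
all: rewrite ?xyE ?xtE ?ytE // (inj_eq lift_inj).
all: by rewrite ?eq_lshift ?eq_rshift ?eq_lrshift ?eq_rlshift.
Qed.

Lemma homogeneous_contact_form p X : superderivation p X -> homogeneous p (contact_form X).
Proof.
move=> dX; apply: homogeneousD; first apply: homogeneousD.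
- by rewrite -[p]addFb; apply: (sder_homog dX); exact: homogeneous_gconst.
- apply: homogeneous_sum => i; apply: homogeneousD; last apply: homogeneousN.
    rewrite -[p]addFb; apply: homogeneousM; first exact: homogeneous_gconst.
    by rewrite -[p]addFb; apply: (sder_homog dX); exact: homogeneous_gconst.
  rewrite -[p]addFb; apply: homogeneousM; first exact: homogeneous_gconst.
  by rewrite -[p]addFb; apply: (sder_homog dX); exact: homogeneous_gconst.
- apply: homogeneous_sum => j; rewrite -[p](addKb true) addbC.
  apply: homogeneousM; last exact: homogeneous_theta.
  by apply: (sder_homog dX); exact: homogeneous_theta.
Qed.

Lemma d_z_zc : d_z (zc R l n) = 1.
Proof. by rewrite /d_z d_even_coord eqxx. Qed.

Lemma xcC i f : xc R n i * f = f * xc R n i.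
Proof. exact: gconst_mulC. Qed.

Lemma ycC i f : yc R n i * f = f * yc R n i.
Proof. exact: gconst_mulC. Qed.

Lemma superderivation_frame p X f : superderivation p X ->
  X f = contact_form X * d_z f + \sum_s X (fcoord s) * Tfield s f.
Proof.
move=> dX; rewrite (superderivation_expand f dX) big_ord_recl big_split_ord frame_sum.
under [X in _ = _ + (X + _ + _)]eq_bigr => i _ do rewrite fcoordE Tfield_fx.
under [X in _ = _ + (_ + X + _)]eq_bigr => i _ do rewrite fcoordE Tfield_fy.
under [X in _ = _ + (_ + _ + X)]eq_bigr => i _ do rewrite fcoordE Tfield_ft.
exact: frame_identity (fun i => xcC i _) (fun i => ycC i _).
Qed.

Lemma sder_contact_form p q X T : superderivation p X -> superderivation q T ->
  X (contact_form T) = X (T (zc R l n)) + \sum_i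
   ((X (xc R n i) * T (yc R n i) + xc R n i * X (T (yc R n i))) -
    (X (yc R n i) * T (xc R n i) + yc R n i * X (T (xc R n i)))) +
   \sum_j (X (T (thetac R l j)) * thetac R l j +
     (-1) ^+ (p && ~~ q) * (T (thetac R l j) * X (thetac R l j))).
Proof.
move=> dX dT; rewrite /contact_form !(sderD dX) !(sder_sum dX).
congr (_ + _ + _); apply: eq_bigr => i _.
  rewrite (sderB dX) (sderM dX _ (homogeneous_gconst _)) (sderM dX _ (homogeneous_gconst _)).
  by rewrite andbF expr0 !mul1r.
rewrite (sderM dX _ (sder_homog dT (homogeneous_theta _ i))).
by rewrite addTb.
Qed.

Lemma tangent_frame q T f : superderivation q T -> contact_form T = 0 ->
  T f = \sum_i (T (xc R n i) * Tfield (fx i) f + T (yc R n i) * Tfield (fy i) f)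
   + \sum_j T (thetac R l j) * Tfield (ft j) f.
Proof.
move=> dT aT; rewrite (superderivation_frame f dT) aT mul0r add0r frame_sum -big_split.
under eq_bigr => i _ do rewrite !fcoordE.
by under [X in _ + X = _]eq_bigr => j _ do rewrite fcoordE.
Qed.

Lemma contact_bracket p q X T : superderivation p X -> superderivation q T ->
  contact_form T = 0 ->
  contact_form (sbracket p q X T) =
  \sum_i ((X (yc R n i) *+ 2 - Tfield (fx i) (contact_form X)) * T (xc R n i) -
          (X (xc R n i) *+ 2 + Tfield (fy i) (contact_form X)) * T (yc R n i)) +
  \sum_j (-1) ^+ q * ((X (thetac R l j) *+ 2 +
     (-1) ^+ p * Tfield (ft j) (contact_form X)) * T (thetac R l j)).
Proof.
move=> dX dT aT.
(* T(alpha(X)) is computed twice, by the frame expansion of T and by the Leibniz rule; [E1] is the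
   Leibniz expansion of X(alpha(T)) = 0. *)
have E3 := tangent_frame (contact_form X) dT aT.
have E1 := sder_contact_form dX dT; rewrite aT (sder0 dX) in E1.
rewrite (sder_contact_form dT dX) in E3.
have hxc i := sder_homog dX (homogeneous_gconst (scoord R (idx_x i))).
have hyc i := sder_homog dX (homogeneous_gconst (scoord R (idx_y i))).
have htc i := sder_homog dX (homogeneous_theta _ i).
have kxc i := sder_homog dT (homogeneous_gconst (scoord R (idx_x i))).
have kyc i := sder_homog dT (homogeneous_gconst (scoord R (idx_y i))).
have ktc i := sder_homog dT (homogeneous_theta _ i).
have hT s := sder_homog (superderivation_Tfield s) (homogeneous_contact_form dX).
rewrite addFb in hxc hyc kxc kyc.
rewrite /contact_form /sbracket; apply: (contact_sum_identity _ _ (esym E1) E3) => i.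
  apply: even_contact_identity.
  - by rewrite (supercommutative (kxc i) (hyc i)) andbC.
  - by rewrite (supercommutative (kyc i) (hxc i)) andbC.
  - have := hT (fx i); rewrite Tparity_fx addbF => h.
    by rewrite (supercommutative (kxc i) h) andbC.
  - have := hT (fy i); rewrite Tparity_fy addbF => h.
    by rewrite (supercommutative (kyc i) h) andbC.
apply: odd_contact_identity.
  exact: (supercommutative (ktc i) (htc i)).
have := hT (ft i); rewrite Tparity_ft addbT => h.
exact: (supercommutative (ktc i) h).
Qed.

End ContactFields.

(** * Coefficients isolated by testing on the frame *)

Section FrameDelta.
Variables (S : pzRingType) (l n : nat).
Variables (A B u v : 'I_l -> S) (C w : 'I_n -> S) (b : bool).
Hypothesis frame0 :
  \sum_k (A k * u k - B k * v k) + \sum_j (-1) ^+ b * (C j * w j) = 0.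

(** Here u, v, w stand for the values of T on the x, y, theta coordinates. For T = T_s they form a
    Kronecker family, so the vanishing sum reduces to a single coefficient. *)
Lemma frame_delta_x i : (forall k, u k = (i == k)%:R) -> (forall k, v k = 0) ->
  (forall j, w j = 0) -> A i = 0.
Proof.
move=> uE v0 w0; rewrite -[RHS]frame0 (bigD1 i)//= uE eqxx mulr1 v0 mulr0 subr0.
rewrite !big1 ?addr0// => [j _|k /negPf ki]; first by rewrite w0 !mulr0.
by rewrite uE eq_sym ki v0 !mulr0 subrr.
Qed.

Lemma frame_delta_y i : (forall k, u k = 0) -> (forall k, v k = (i == k)%:R) ->
  (forall j, w j = 0) -> B i = 0.
Proof.
move=> u0 vE w0; apply/eqP; rewrite -oppr_eq0; apply/eqP.
rewrite -[RHS]frame0 (bigD1 i)//= vE eqxx mulr1 u0 mulr0 sub0r.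
rewrite !big1 ?addr0// => [j _|k /negPf ki]; first by rewrite w0 !mulr0.
by rewrite vE eq_sym ki u0 !mulr0 subrr.
Qed.

Lemma frame_delta_t j : (forall k, u k = 0) -> (forall k, v k = 0) ->
  (forall k, w k = (j == k)%:R) -> C j = 0.
Proof.
move=> u0 v0 wE; apply: (can_inj (signrMK b)); rewrite mulr0 -[RHS]frame0 (bigD1 j)//=.
rewrite wE eqxx mulr1 !big1 ?addr0 ?add0r// => [k /negPf kj|k _].
  by rewrite wE eq_sym kj !mulr0.
by rewrite u0 v0 !mulr0 subrr.
Qed.

End FrameDelta.

(** * The fields X_f and their characterization among homogeneous fields *)

Section ContactHamiltonians.
Variables (R : realType) (l n : nat).
Local Notation SF := (superfun R l n).
Implicit Types (f g : SF) (p q : bool) (X Y T : SF -> SF) (r s : 'I_(l + l + n)).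

Lemma contact_formD X Y : contact_form (fun f => X f + Y f) = contact_form X + contact_form Y.
Proof.
have linE (S : pzRingType) (a a' : S) (x y b b' c c' : 'I_l -> S) (t d d' : 'I_n -> S) :
    (a + a') + \sum_i (x i * (b i + b' i) - y i * (c i + c' i)) + \sum_j (d j + d' j) * t j =
    (a + \sum_i (x i * b i - y i * c i) + \sum_j d j * t j) +
    (a' + \sum_i (x i * b' i - y i * c' i) + \sum_j d' j * t j).
  rewrite [RHS]addrACA (addrACA a).
  rewrite -!big_split; congr (_ + _ + _); apply: eq_bigr => i _.
    by rewrite !mulrDr opprD addrACA.
  by rewrite mulrDl.
exact: linE.
Qed.

(** The component along [T_s] of [X_f] for [f] of parity [p]. *)
Definition hcoef p f s : SF :=
  - (2^-1 *: \sum_r ((-1) ^+ (p && Tparity r) * omega R l n r s) *: Tfield r f).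

Lemma Xham_homogE p f g :
  Xham_homog p f g = f * d_z g + \sum_s hcoef p f s * Tfield s g.
Proof.
rewrite /Xham_homog exchange_big scaler_sumr -sumrN; congr (_ + _).
apply: eq_bigr => s _; rewrite /hcoef mulNr sf_scalerAl mulr_suml.
by congr (- (_ *: _)); apply: eq_bigr => r _; rewrite sf_scalerAl.
Qed.

Lemma omegaE : ((forall i k, omega R l n (fx n i) (fx n k) = 0) *
  (forall i k, omega R l n (fx n i) (fy n k) = - (i == k)%:R) *
  (forall i k, omega R l n (fy n i) (fx n k) = (i == k)%:R) *
  (forall i k, omega R l n (fy n i) (fy n k) = 0) *
  (forall i j, omega R l n (fx n i) (ft l j) = 0) *
  (forall i j, omega R l n (fy n i) (ft l j) = 0) *
  (forall i j, omega R l n (ft l j) (fx n i) = 0) *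
  (forall i j, omega R l n (ft l j) (fy n i) = 0) *
  (forall j k, omega R l n (ft l j) (ft l k) = (j == k)%:R))%type.
Proof.
by rewrite /omega; do !split; move=> i k;
  rewrite ?(block_mxEul, block_mxEur, block_mxEdl, block_mxEdr) !mxE.
Qed.

Lemma sum_scale_delta k (F : 'I_k -> SF) (c : 'I_k -> R) i :
  \sum_j (c j * (j == i)%:R) *: F j = c i *: F i.
Proof.
rewrite (bigD1 i)//= eqxx mulr1 big1 ?addr0// => j /negPf ->.
by rewrite mulr0 scale0r.
Qed.

Lemma hcoef_fx p f i : hcoef p f (fx n i) = - (2^-1 *: Tfield (fy n i) f).
Proof.
rewrite /hcoef frame_sum.
under eq_bigr => k _ do rewrite omegaE mulr0 scale0r.
under [X in _ + X + _]eq_bigr => k _ do rewrite omegaE Tparity_fy andbF.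
under [X in _ + _ + X]eq_bigr => k _ do rewrite omegaE mulr0 scale0r.
by rewrite sum_scale_delta !big1_eq add0r addr0 scale1r.
Qed.

Lemma hcoef_fy p f i : hcoef p f (fy n i) = 2^-1 *: Tfield (fx n i) f.
Proof.
rewrite /hcoef frame_sum.
under eq_bigr => k _ do rewrite omegaE Tparity_fx andbF mulrN -mulNr.
under [X in _ + X + _]eq_bigr => k _ do rewrite omegaE mulr0 scale0r.
under [X in _ + _ + X]eq_bigr => k _ do rewrite omegaE mulr0 scale0r.
by rewrite sum_scale_delta !big1_eq !addr0 scaleN1r scalerN opprK.
Qed.

Lemma hcoef_ft p f j : hcoef p f (ft l j) = - (2^-1 *: ((-1) ^+ p * Tfield (ft l j) f)).
Proof.
rewrite /hcoef frame_sum.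
under eq_bigr => k _ do rewrite omegaE mulr0 scale0r.
under [X in _ + X + _]eq_bigr => k _ do rewrite omegaE mulr0 scale0r.
under [X in _ + _ + X]eq_bigr => k _ do rewrite omegaE Tparity_ft andbT.
rewrite sum_scale_delta !big1_eq !add0r; congr (- (_ *: _)).
by case: p; rewrite ?scaleN1r ?scale1r ?mulN1r ?mul1r.
Qed.

(** [omega] pairs only frame fields of equal parity, so the coefficient along T_s involves
    derivatives T_r f with r of the parity of s. *)
Lemma homogeneous_hcoef p f s : homogeneous p f -> homogeneous (p (+) Tparity s) (hcoef p f s).
Proof.
move=> hf; elim/frame_ind: s => i.
- rewrite hcoef_fx; apply/homogeneousN/homogeneousZ.
  by rewrite Tparity_fx -(Tparity_fy n i); exact: (sder_homog (superderivation_Tfield R _) hf).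
- rewrite hcoef_fy; apply/homogeneousZ.
  by rewrite Tparity_fy -(Tparity_fx n i); exact: (sder_homog (superderivation_Tfield R _) hf).
- rewrite hcoef_ft; apply/homogeneousN/homogeneousZ/homogeneous_sign.
  exact: (sder_homog (superderivation_Tfield R _) hf).
Qed.

Lemma superderivation_Xham p f : homogeneous p f -> superderivation p (Xham_homog p f).
Proof.
move=> hf; apply: (sder_ext (fun g => esym (Xham_homogE p f g))).
apply: superderivationD.
  apply: (superderivationMl hf (superderivation_d_even _ _ _)); by rewrite addbF.
apply: superderivation_sum => s.
apply: (superderivationMl (homogeneous_hcoef hf) (superderivation_Tfield R s)).
by rewrite -addbA addbb addbF.
Qed.

(** The coordinates [fcoord] are killed by d_z and dual to the T_s, so they read off the c_s.
    Comparison with the frame expansion at z then identifies the coefficient of d_z as alpha(X).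
    This yields alpha(X_f) = f and alpha(T_s) = 0. *)
Lemma frame_unique p X f (c : 'I_(l + l + n) -> SF) : superderivation p X ->
  (forall g, X g = f * d_z g + \sum_s c s * Tfield s g) ->
  contact_form X = f /\ forall s, X (fcoord R s) = c s.
Proof.
move=> dX XE; have Xc s : X (fcoord R s) = c s.
  rewrite XE d_z_fcoord mulr0 add0r (bigD1 s)//= Tfield_fcoord eqxx mulr1.
  rewrite big1 ?addr0// => r /negPf rs.
  by rewrite Tfield_fcoord rs mulr0.
split=> //; have := superderivation_frame (zc R l n) dX.
rewrite {1}XE d_z_zc !mulr1; under [X in _ = _ + X]eq_bigr => s _ do rewrite Xc.
by move/addIr.
Qed.

Lemma contact_form_Tfield s : contact_form (@Tfield R l n s) = 0.
Proof.
have TE g : Tfield s g = 0 * d_z g + \sum_r (s == r)%:R * Tfield r g.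
  rewrite mul0r add0r (bigD1 s)//= eqxx mul1r big1 ?addr0// => r /negPf rs.
  by rewrite eq_sym rs mul0r.
by have [] := frame_unique (superderivation_Tfield R s) TE.
Qed.

Lemma double_half (V : lmodType R) (a b : V) : (2^-1 *: b = a) <-> (a *+ 2 = b).
Proof.
split=> [<-|<-].
  by rewrite -[LHS]scaler_nat scalerA mulfV ?scale1r.
by rewrite -[a *+ 2]scaler_nat scalerA mulVf ?scale1r.
Qed.

(** With the components of X_f, every bracketed coefficient in [contact_bracket] vanishes
    identically, whatever the tangent T. *)
Lemma Xham_tangent p q f T : homogeneous p f -> superderivation q T ->
  contact_form T = 0 -> contact_form (sbracket p q (Xham_homog p f) T) = 0.
Proof.
move=> hf dT aT; have dX := superderivation_Xham hf.
have [aX Xc] := frame_unique dX (Xham_homogE p f).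
have Xx i : Xham_homog p f (xc R n i) = - (2^-1 *: Tfield (fy n i) f).
  by rewrite -(fcoordE R l n).1.1 Xc hcoef_fx.
have Xy i : Xham_homog p f (yc R n i) = 2^-1 *: Tfield (fx n i) f.
  by rewrite -(fcoordE R l n).1.2 Xc hcoef_fy.
have Xt j : Xham_homog p f (thetac R l j) = - (2^-1 *: ((-1) ^+ p * Tfield (ft l j) f)).
  by rewrite -(fcoordE R l n).2 Xc hcoef_ft.
have dbl (a : SF) : (2^-1 *: a) *+ 2 = a by exact/double_half.
rewrite (contact_bracket dX dT aT) aX !big1 ?addr0// => i _.
  by rewrite Xt mulNrn dbl addNr mul0r mulr0.
by rewrite Xx Xy mulNrn !dbl subrr addNr !mul0r subrr.
Qed.

Lemma frame_neq : ((forall i k : 'I_l, (fx n i == fy n k) = false) *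
  (forall i k : 'I_l, (fy n i == fx n k) = false) * (forall (i : 'I_l) j, (fx n i == ft l j) = false) *
  (forall (i : 'I_l) j, (fy n i == ft l j) = false) * (forall (i : 'I_l) j, (ft l j == fx n i) = false) *
  (forall (i : 'I_l) j, (ft l j == fy n i) = false))%type.
Proof.
have xy (i k : 'I_l) : (fx n i == fy n k) = false by rewrite eq_lshift eq_lrshift.
do !split; move=> i k; rewrite ?xy ?eq_lrshift ?eq_rlshift//.
by rewrite eq_sym xy.
Qed.

Lemma tangent_Xham p X : superderivation p X ->
  (forall s, contact_form (sbracket p (Tparity s) X (@Tfield R l n s)) = 0) ->
  forall g, X g = Xham_homog p (contact_form X) g.
Proof.
move=> dX Xtan g; rewrite (superderivation_frame g dX) Xham_homogE; congr (_ + _).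
apply: eq_bigr => s _; congr (_ * _).
have Tx r k : Tfield r (xc R n k) = (r == fx n k)%:R by rewrite -(fcoordE R l n).1.1 Tfield_fcoord.
have Ty r k : Tfield r (yc R n k) = (r == fy n k)%:R by rewrite -(fcoordE R l n).1.2 Tfield_fcoord.
have Tt r j : Tfield r (thetac R l j) = (r == ft l j)%:R by rewrite -(fcoordE R l n).2 Tfield_fcoord.
have Xs s := contact_bracket dX (superderivation_Tfield R s) (contact_form_Tfield s).
have xx i' k : (fx n i' == fx n k) = (i' == k) by rewrite !eq_lshift.
have yy i' k : (fy n i' == fy n k) = (i' == k) by rewrite eq_lshift eq_rshift.
have tt j k : (ft l j == ft l k) = (j == k) by rewrite eq_rshift.
elim/frame_ind: s => i.
(* The components along x and y cross over: the value X(x_i) multiplies T(y_i) in the bracket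
   formula, so it is detected by T_{y_i}. *)
- rewrite fcoordE hcoef_fx; have := Xtan (fy n i).
  rewrite Xs => /frame_delta_y/(_ i) H; apply/esym.
  rewrite -scalerN; apply/double_half/eqP; rewrite -addr_eq0; apply/eqP.
  by apply: H => k; rewrite ?Tx ?Ty ?Tt ?yy ?frame_neq.
- rewrite fcoordE hcoef_fy; have := Xtan (fx n i).
  rewrite Xs => /frame_delta_x/(_ i) H; apply/esym.
  apply/double_half/eqP; rewrite -subr_eq0; apply/eqP.
  by apply: H => k; rewrite ?Tx ?Ty ?Tt ?xx ?frame_neq.
- rewrite fcoordE hcoef_ft; have := Xtan (ft l i).
  rewrite Xs => /frame_delta_t/(_ i) H; apply/esym.
  rewrite -scalerN; apply/double_half/eqP; rewrite -addr_eq0; apply/eqP.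
  by apply: H => k; rewrite ?Tx ?Ty ?Tt ?tt ?frame_neq.
Qed.

End ContactHamiltonians.

(** * Passage from homogeneous to arbitrary vector fields *)

Section VectorFields.
Variables (R : realType) (l n : nat).
Local Notation SF := (superfun R l n).
Implicit Types (f g : SF) (p q : bool) (X Y T : SF -> SF)
  (r : 'I_(l + l + n)).

Lemma superderivation0 p : superderivation p (fun _ : SF => 0).
Proof.
split=> [a f g|q f _|q f g _]; first by rewrite scaler0 addr0.
  exact: homogeneous0.
by rewrite mul0r mulr0 mulr0 addr0.
Qed.

(** [X_ r] sends parity q to parity q + r, so the component of parity q + p of the image of
    [gpart q f] comes from [X_ p] alone. *)
Lemma op_part_sum (X_ : bool -> SF -> SF) p : (forall q, superderivation q (X_ q)) ->
  op_part p (fun f => X_ false f + X_ true f) = X_ p.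
Proof.
move=> dX; apply/funext => f; rewrite /op_part big_bool.
have XE q : gpart (q (+) p) (X_ false (gpart q f) + X_ true (gpart q f)) = X_ p (gpart q f).
  have hX (r : bool) : homogeneous (q (+) r) (X_ r (gpart q f)).
    exact: (sder_homog (dX r) (@homogeneous_gpart _ _ q f)).
  rewrite gpartD; case: p.
    by rewrite (gpart_id (hX true)) (gpart_neq (hX false)) ?add0r//; case: (q).
  by rewrite (gpart_id (hX false)) (gpart_neq (hX true)) ?addr0//; case: (q).
by rewrite !XE /= -(sderD (dX p)) addrC -gpart_sum.
Qed.

(** The component of parity r of [X, T], from the two pairs of parities with sum r. *)
Definition bracket_part (X_ T_ : bool -> SF -> SF) (r : bool) : SF -> SF :=
  fun f => sbracket false r (X_ false) (T_ r) f + sbracket true (~~ r) (X_ true) (T_ (~~ r)) f.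

Lemma bracket_sum (X_ T_ : bool -> SF -> SF) :
  (forall q, superderivation q (X_ q)) -> (forall q, superderivation q (T_ q)) ->
  bracket (fun f => X_ false f + X_ true f) (fun f => T_ false f + T_ true f) =
  (fun f => bracket_part X_ T_ false f + bracket_part X_ T_ true f).
Proof.
have sum_bool2 (V : nmodType) (G : bool -> bool -> V) : \sum_p \sum_q G p q =
    (G false false + G true true) + (G false true + G true false).
  by rewrite !big_bool /= (AC (2*2) ((4*1)*(3*2))).
move=> dX dT; apply/funext => f.
rewrite /bracket_part -(sum_bool2 _ (fun p q => sbracket p q (X_ p) (T_ q) f)) /bracket.
apply: eq_bigr => p _; apply: eq_bigr => q _.
by rewrite (op_part_sum _ dX) (op_part_sum _ dT).
Qed.

Lemma superderivation_bracket_part (X_ T_ : bool -> SF -> SF) (r : bool) :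
  (forall q, superderivation q (X_ q)) -> (forall q, superderivation q (T_ q)) ->
  superderivation r (bracket_part X_ T_ r).
Proof.
move=> dX dT; apply: superderivationD.
  exact: (superderivation_sbracket (dX false) (dT r)).
by have := superderivation_sbracket (dX true) (dT (~~ r)); rewrite addTb negbK.
Qed.

Lemma contact_form_bracket_part (X_ T_ : bool -> SF -> SF) (r : bool) :
  contact_form (bracket_part X_ T_ r) =
  contact_form (sbracket false r (X_ false) (T_ r)) +
  contact_form (sbracket true (~~ r) (X_ true) (T_ (~~ r))).
Proof. exact: contact_formD. Qed.

Lemma contact_form0 : contact_form (fun _ : SF => 0 : SF) = 0.
Proof.
have := contact_formD (fun _ : SF => 0 : SF) (fun=> 0).
have -> : (fun _ : SF => 0 + 0 : SF) = (fun=> 0) by apply/funext => f; rewrite addr0.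
by move=> /esym/eqP; rewrite -subr_eq0 addrK => /eqP.
Qed.

Lemma contact_form_sbracket0 p q X : superderivation p X ->
  contact_form (sbracket p q X (fun=> 0)) = 0.
Proof.
move=> dX; rewrite -[RHS]contact_form0; congr contact_form; apply/funext => f.
by rewrite /sbracket (sder0 dX) mulr0 subrr.
Qed.

Lemma vector_fieldP X : vector_field X <->
  exists2 X_ : bool -> SF -> SF, forall q, superderivation q (X_ q) &
    X = fun f => X_ false f + X_ true f.
Proof.
split=> [[X0 [X1 [dX0 dX1 XE]]]|[X_ dX ->]].
  exists (fun q => if q then X1 else X0); first by case.
  exact/funext.
by exists (X_ false), (X_ true).
Qed.

(** The values of alpha on the even and odd parts have different parities and cannot cancel, so
    homogeneous parts of tangent fields are tangent. *)
Lemma contact_form_parts (X_ : bool -> SF -> SF) :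
  (forall q, superderivation q (X_ q)) ->
  contact_form (fun f => X_ false f + X_ true f) = 0 -> forall q, contact_form (X_ q) = 0.
Proof.
move=> dX; rewrite contact_formD => /homogeneous_add_eq0[||a0 a1].
- exact: homogeneous_contact_form.
- exact: homogeneous_contact_form.
by move=> [].
Qed.

Lemma contact_form_bracket_eq0 (X_ T_ : bool -> SF -> SF) :
  (forall q, superderivation q (X_ q)) -> (forall q, superderivation q (T_ q)) ->
  (forall p q, contact_form (sbracket p q (X_ p) (T_ q)) = 0) ->
  contact_form (bracket (fun f => X_ false f + X_ true f) (fun f => T_ false f + T_ true f)) = 0.
Proof.
move=> dX dT XT0.
have add0 (a b : SF) : a = 0 -> b = 0 -> a + b = 0 by move=> -> ->; rewrite addr0.
have B0 q : contact_form (bracket_part X_ T_ q) = 0.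
  by rewrite contact_form_bracket_part; exact: add0 (XT0 false q) (XT0 true (~~ q)).
by rewrite (bracket_sum dX dT) contact_formD; exact: add0 (B0 false) (B0 true).
Qed.

Lemma vector_field_bracket X T : vector_field X -> vector_field T -> vector_field (bracket X T).
Proof.
move=> /vector_fieldP[X_ dX ->] /vector_fieldP[T_ dT ->]; rewrite (bracket_sum dX dT).
apply/vector_fieldP; exists (bracket_part X_ T_) => [q|]; last by [].
exact: superderivation_bracket_part.
Qed.

(** T_r, which is homogeneous, written as a family of an even and an odd part so that the lemmas on
    sums of two parts apply to it. *)
Definition Tfield_part r p : SF -> SF :=
  if Tparity r == p then @Tfield R l n r else fun=> 0.

Lemma superderivation_Tfield_part r p : superderivation p (Tfield_part r p).
Proof.
rewrite /Tfield_part; case: eqP => [<-|_]; first exact: superderivation_Tfield.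
exact: superderivation0.
Qed.

Lemma Tfield_sum r : @Tfield R l n r = fun f => Tfield_part r false f + Tfield_part r true f.
Proof.
rewrite /Tfield_part; apply/funext => f.
by case: (Tparity r) => /=; rewrite ?add0r ?addr0.
Qed.

Lemma Tan_Tfield r : Tan (@Tfield R l n r).
Proof.
split; last exact: contact_form_Tfield.
apply/vector_fieldP; exists (Tfield_part r); first exact: superderivation_Tfield_part.
exact: Tfield_sum.
Qed.

(** Since T_r has a single nonzero part, the component of [X, T_r] of parity p plus that of T_r is
    [X_p, T_r] plus a bracket with 0, and alpha vanishes on each component separately. *)
Lemma contact_parts (X_ : bool -> SF -> SF) r : (forall q, superderivation q (X_ q)) ->
  contact_form (bracket (fun f => X_ false f + X_ true f) (@Tfield R l n r)) = 0 ->
  forall p, contact_form (sbracket p (Tparity r) (X_ p) (@Tfield R l n r)) = 0.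
Proof.
move=> dX; have dT := superderivation_Tfield_part r.
rewrite (Tfield_sum r) (bracket_sum dX dT) => bT p.
have dB q := superderivation_bracket_part q dX dT.
have := contact_form_parts dB bT (p (+) Tparity r).
rewrite contact_form_bracket_part -(Tfield_sum r).
have Tr : Tfield_part r (Tparity r) = Tfield r by rewrite /Tfield_part eqxx.
have T0 : Tfield_part r (~~ Tparity r) = fun=> 0.
  by rewrite /Tfield_part; case: (Tparity r).
case: p; rewrite ?addTb ?addFb ?negbK Tr T0.
  by rewrite (contact_form_sbracket0 _ (dX false)) add0r.
by rewrite (contact_form_sbracket0 _ (dX true)) addr0.
Qed.

End VectorFields.

Theorem proposition6p2 (R : realType) (l n : nat) (hn : (1 <= n)%N)
    (X : superfun R l n -> superfun R l n) (hX : vector_field X) :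
  contact_vector_field X <-> exists f : superfun R l n, X = Xham f.
Proof.
split=> [[_ Xtan]|[f XE]].
  have /vector_fieldP[X_ dX XE] := hX.
  have XT p r : contact_form (sbracket p (Tparity r) (X_ p) (@Tfield R l n r)) = 0.
    apply: contact_parts => //; rewrite -XE.
    by have [] := Xtan _ (Tan_Tfield R r).
  have [f hf XH] : exists2 f : bool -> superfun R l n, forall p, homogeneous p (f p) &
      forall p g, X_ p g = Xham_homog p (f p) g.
    (* Each homogeneous part has its value of alpha as Hamiltonian. These values have the parities
       of the parts, so [gpart] recovers them from their sum. *)
    exists (fun p => contact_form (X_ p)) => p; first exact: homogeneous_contact_form.
    exact: tangent_Xham.
  exists (f false + f true).
  have gp p : gpart p (f false + f true) = f p.
    rewrite gpartD; case: p.
      by rewrite (gpart_neq (hf false))// (gpart_id (hf true)) add0r.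
    by rewrite (gpart_id (hf false)) (gpart_neq (hf true))// addr0.
  by rewrite XE; apply/funext => g; rewrite /Xham !gp -!XH.
split; first by [].
move=> T [vT aT]; split; first exact: vector_field_bracket.
(* T is split into homogeneous parts, again tangent, and paired with the fields of the two
   homogeneous parts of f. *)
move: vT aT => /vector_fieldP[T_ dT ->] /(contact_form_parts dT) aT.
rewrite XE; apply: (@contact_form_bracket_eq0 _ _ _ (fun p => Xham_homog p (gpart p f)) T_).
- by move=> p; exact: superderivation_Xham (@homogeneous_gpart _ _ p f).
- exact: dT.
- move=> p q; exact: (Xham_tangent (@homogeneous_gpart _ _ p f) (dT q) (aT q)).
Qed.
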